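(* Let $n\ge 2$, $\gamma\ge1$, $\mu>0$, $\kappa>0$, $\rho_+>0$. Then there exist a positive constant $\delta$ and a positive constant $C=C(n,\kappa,\rho_+)$ such that the following holds. If $\rho_b\in\mathbb{R}$ and $u_-\in\mathbb{R}$, $u_-\ne0$, satisfy $|\rho_b|<\delta$ and $|u_-|<\delta$, then there exists a unique smooth solution $(\tilde\rho,\tilde u)$ on $[1,\infty)$, with $\tilde\rho>0$, to $$\frac{1}{r^{n-1}}(r^{n-1}\tilde\rho\tilde u)_r=0,\qquad \tilde\rho\tilde u\tilde u_r+P(\tilde\rho)_r=\mu\left(\frac{(r^{n-1}\tilde u)_r}{r^{n-1}}\right)_r+\kappa\tilde\rho\left(\tilde\rho_{rr}+\frac{n-1}{r}\tilde\rho_r\right)_r,\qquad r>1,$$ $$\lim_{r\to\infty}(\tilde\rho(r),\tilde u(r))=(\rho_+,0),\qquad \tilde u(1)=u_-,\qquad \tilde\rho_r(1)=\rho_b,$$ satisfying, for all $r\ge1$, $$|\tilde\rho(r)-\rho_+|\le C(|\rho_b|+|u_-|^2)r^{-2(n-1)},\qquad |\tilde\rho_r(r)|\le C(|\rho_b|+|u_-|^2)r^{-(2n-1)},$$ and $$C^{-1}|u_-|r^{-(n-1)}\le|\tilde u(r)|\le C|u_-|r^{-(n-1)}.$$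
   Context: This is the stationary problem for the spherically symmetric compressible Navier--Stokes--Korteweg equations on the exterior domain $\{x\in\mathbb{R}^n: |x|>1\}$; $r=|x|$, subscript $r$ denotes $d/dr$, $\tilde\rho$ is the density, $\tilde u$ the radial velocity, $\mu$ the viscosity coefficient, $\kappa$ the capillarity coefficient. The pressure is $P(\rho)=\rho^\gamma$ with fixed $\gamma\ge1$. The case $u_->0$ is the inflow problem and $u_-<0$ the outflow problem. The value $\tilde\rho(1)$ is not prescribed. The parameters $\gamma$ and $\mu$ are regarded as fixed. *)

(* Defs.v *)
From Stdlib Require Import Reals.
From Coquelicot Require Import Coquelicot.
Open Scope R_scope.

(* Functions on [1, oo) are represented by total functions R -> R; only their
   values on [1, oo) are meaningful. *)
Definition halfline (r : R) : Prop := 1 <= r.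

(* [D_in f df halfline r] is the derivative relative to [1, oo): two-sided for
   r > 1, one-sided at r = 1. *)
Definition is_deriv_halfline (f df : R -> R) : Prop :=
  forall r, 1 <= r -> D_in f df halfline r.

Definition smooth_halfline (f : R -> R) : Prop :=
  exists F : nat -> R -> R,
    (forall r, 1 <= r -> F 0%nat r = f r) /\
    (forall k, is_deriv_halfline (F k) (F (S k))).

(* Meaningful for rho > 0 only. *)
Definition pressure (gamma rho : R) : R := Rpower rho gamma.

(* For r > 1, [Derive] only depends on values in (1, oo). *)
Definition continuity_eq (n : nat) (rho u : R -> R) (r : R) : Prop :=
  / r ^ (n - 1) * Derive (fun s => s ^ (n - 1) * rho s * u s) r = 0.

Definition momentum_eq (n : nat) (gamma mu kappa : R) (rho u : R -> R) (r : R)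
  : Prop :=
  rho r * u r * Derive u r + Derive (fun s => pressure gamma (rho s)) r
  = mu * Derive (fun s => Derive (fun t => t ^ (n - 1) * u t) s / s ^ (n - 1)) r
    + kappa * rho r
      * Derive (fun s => Derive_n rho 2 s + (INR n - 1) / s * Derive rho s) r.

Definition stationary_solution (n : nat) (gamma mu kappa rho_plus rho_b u_m : R)
    (rho u : R -> R) : Prop :=
  smooth_halfline rho /\ smooth_halfline u /\
  (forall r, 1 <= r -> 0 < rho r) /\
  (forall r, 1 < r -> continuity_eq n rho u r) /\
  (forall r, 1 < r -> momentum_eq n gamma mu kappa rho u r) /\
  is_lim rho p_infty rho_plus /\ is_lim u p_infty 0 /\
  u 1 = u_m /\
  D_in rho (fun _ => rho_b) halfline 1.

Definition decay_estimates (n : nat) (C rho_plus rho_b u_m : R)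
    (rho u : R -> R) : Prop :=
  exists rho_r : R -> R,
    is_deriv_halfline rho rho_r /\
    forall r, 1 <= r ->
      Rabs (rho r - rho_plus)
        <= C * (Rabs rho_b + Rabs u_m ^ 2) * / r ^ (2 * (n - 1)) /\
      Rabs (rho_r r)
        <= C * (Rabs rho_b + Rabs u_m ^ 2) * / r ^ (2 * n - 1) /\
      / C * Rabs u_m * / r ^ (n - 1) <= Rabs (u r) /\
      Rabs (u r) <= C * Rabs u_m * / r ^ (n - 1).

(* Main.v *)
Require Import Defs.
From Stdlib Require Import Reals.
From Coquelicot Require Import Coquelicot.
From Stdlib Require Import Lra Lia IndefiniteDescription.
Open Scope R_scope.

(* By the continuity equation, u = m / (rho r^(n-1)) with m = rho(1) u_-, so the
   momentum equation divided by kappa rho is a third-order equation for rho, i.e.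
   v' = lam^2 w + source(r, rho, w, v) for w = rho' and v = w'. In the variables
   p = v - lam w, q = v + lam w it reads p' = - lam p + source,
   q' = lam q + source; p is integrated forwards from r = 1 and q backwards from
   infinity, while w(1) = rho_b and rho(oo) = rho_+ fix the constants. Since lam
   is large, the linear part of the source is bounded by
   (lam - alpha / lam) max(|p|, |q|), where alpha = P'(rho_+) / (kappa rho_+) > 0,
   so the fixed-point map contracts the supremum norm weighted by
   (r + A)^-(2n-1), A large; the other terms are small perturbations. The fixed
   point satisfies the decay estimates. Conversely a decaying solution has
   controlled rho'': a suitable combination of v and w has a derivative free of v,
   and the mean value theorem on [r, r+1] bounds v. Hence it lies in the ball
   where the contraction gives uniqueness. *)

(** The linearisation at [rho_inf] is [v' = (alpha + NN / r^2) w - (NN / r) v]. Without curvature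
    its rates would be plus and minus the square root of [alpha], but the [NN] terms are not small
    near r = 1 and cannot count as perturbations of that system. So [lam] is deliberately not the
    spectral rate: [lam^2 w] is added and subtracted, and for [lam] large the first-order curvature
    term drops out of the supremum bound of what is subtracted, which leaves the gain [alpha / lam].
    That gain is the whole budget. A quarter of it ([slack]) pays for the nonlinear terms, a quarter
    for the variation of the weight, and the remaining half for the contraction and the data. The
    decay power is that of the only forcing felt by the constant state, the geometric part of the
    convective term. The flux m contains the unprescribed value rho(1), so it is part of the unknown
    and changes at each iteration. The constants are chosen in a fixed order: C comes from
    existence, the radius of the uniqueness ball depends on C, and delta is chosen last. *)

(** * Calculus on the half-line, with one-sided behaviour at 1 *)

(* Functions on [1, oo) are extended to the left of 1 by their value at 1. *)
Definition hcont (f : R -> R) : Prop := continuity (fun s => f (Rmax 1 s)).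

(* Differentiability at the endpoint is not required: the comparison
   arguments only need continuity there. *)
Definition hderiv (f df : R -> R) : Prop :=
  hcont f /\ forall r, 1 < r -> is_derive f r (df r).

Lemma continuity_Rmax1 : continuity (Rmax 1).
Proof.
  intros x. apply continuity_pt_filterlim, filterlim_locally. intros eps.
  exists eps. intros y Hy.
  unfold ball in *; simpl in *; unfold AbsRing_ball, abs, minus, plus, opp in *;
    simpl in *.
  apply Rabs_def2 in Hy. apply Rabs_def1;
  unfold Rmax; destruct (Rle_dec 1 y), (Rle_dec 1 x); lra.
Qed.

Lemma hcont_of_cont (f : R -> R) :
  (forall r, 1 <= r -> continuity_pt f r) -> hcont f.
Proof.
  intros H r. apply (continuity_pt_comp (Rmax 1) f r).
  - apply continuity_Rmax1.
  - apply H, Rmax_l.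
Qed.

Lemma hcont_comp (g f : R -> R) :
  hcont f -> (forall r, 1 <= r -> continuity_pt g (f r)) ->
  hcont (fun r => g (f r)).
Proof.
  intros Hf Hg r. apply (continuity_pt_comp (fun s => f (Rmax 1 s)) g r).
  - apply Hf.
  - apply Hg, Rmax_l.
Qed.

Lemma hcont_plus (f g : R -> R) :
  hcont f -> hcont g -> hcont (fun r => f r + g r).
Proof. intros Hf Hg r. exact (continuity_pt_plus _ _ r (Hf r) (Hg r)). Qed.

Lemma hcont_minus (f g : R -> R) :
  hcont f -> hcont g -> hcont (fun r => f r - g r).
Proof. intros Hf Hg r. exact (continuity_pt_minus _ _ r (Hf r) (Hg r)). Qed.

Lemma hcont_mult (f g : R -> R) :
  hcont f -> hcont g -> hcont (fun r => f r * g r).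
Proof. intros Hf Hg r. exact (continuity_pt_mult _ _ r (Hf r) (Hg r)). Qed.

Lemma hcont_const (c : R) : hcont (fun _ => c).
Proof. intros r. apply continuity_pt_const. now intros x y. Qed.

Lemma hcont_id : hcont (fun r => r).
Proof. intros r. apply continuity_Rmax1. Qed.

Lemma hcont_inv (f : R -> R) :
  hcont f -> (forall r, 1 <= r -> f r <> 0) -> hcont (fun r => / f r).
Proof.
  intros Hf H0 r. apply (continuity_pt_inv _ r (Hf r)), H0, Rmax_l.
Qed.

Lemma hcont_ext (f g : R -> R) :
  (forall r, 1 <= r -> f r = g r) -> hcont f -> hcont g.
Proof.
  intros E Hf r. apply (continuity_pt_ext (fun s => f (Rmax 1 s))).
  - intros s. apply E, Rmax_l.
  - apply Hf.
Qed.

Lemma locally_gt (a r : R) (P : R -> Prop) :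
  a < r -> (forall s, a < s -> P s) -> locally r P.
Proof.
  intros Hr HP. assert (H : 0 < r - a) by lra.
  exists (mkposreal _ H). intros y Hy. apply HP.
  unfold ball in Hy; simpl in Hy;
    unfold AbsRing_ball, abs, minus, plus, opp in Hy; simpl in Hy.
  apply Rabs_def2 in Hy. lra.
Qed.

Lemma hderiv_of_derive (f df : R -> R) :
  (forall r, 1 <= r -> is_derive f r (df r)) -> hderiv f df.
Proof.
  intros H. split.
  - apply hcont_of_cont. intros r Hr. apply continuity_pt_filterlim.
    apply (ex_derive_continuous f). exists (df r). now apply H.
  - intros r Hr. apply H. lra.
Qed.

Lemma hderiv_ext (f g df dg : R -> R) :
  (forall r, 1 <= r -> f r = g r) -> (forall r, 1 < r -> df r = dg r) ->
  hderiv f df -> hderiv g dg.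
Proof.
  intros E E' [Hc Hd]. split.
  - now apply (hcont_ext f).
  - intros r Hr. rewrite <- E' by easy. apply (is_derive_ext_loc f); [|auto].
    apply (locally_gt 1); [easy|]. intros s Hs. apply E. lra.
Qed.

Lemma hderiv_plus (f g df dg : R -> R) :
  hderiv f df -> hderiv g dg ->
  hderiv (fun r => f r + g r) (fun r => df r + dg r).
Proof.
  intros [Hf Hf'] [Hg Hg']. split; [now apply hcont_plus|].
  intros r Hr. apply (is_derive_plus f g r); auto.
Qed.

Lemma hderiv_minus (f g df dg : R -> R) :
  hderiv f df -> hderiv g dg ->
  hderiv (fun r => f r - g r) (fun r => df r - dg r).
Proof.
  intros [Hf Hf'] [Hg Hg']. split; [now apply hcont_minus|].
  intros r Hr. apply (is_derive_minus f g r); auto.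
Qed.

Lemma hderiv_mult (f g df dg : R -> R) :
  hderiv f df -> hderiv g dg ->
  hderiv (fun r => f r * g r) (fun r => df r * g r + f r * dg r).
Proof.
  intros [Hf Hf'] [Hg Hg']. split; [now apply hcont_mult|].
  intros r Hr. apply (is_derive_mult f g r); auto. intros; apply Rmult_comm.
Qed.

Lemma hderiv_const (c : R) : hderiv (fun _ => c) (fun _ => 0).
Proof. apply hderiv_of_derive. intros; apply @is_derive_const. Qed.

Lemma hderiv_scal (c : R) (f df : R -> R) :
  hderiv f df -> hderiv (fun r => c * f r) (fun r => c * df r).
Proof.
  intros H. eapply hderiv_ext; [| |apply (hderiv_mult _ _ _ _ (hderiv_const c) H)].
  - reflexivity.
  - intros r _; simpl; ring.
Qed.

Lemma hderiv_comp (g f df : R -> R) (dg : R -> R) :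
  hderiv f df -> (forall r, 1 <= r -> is_derive g (f r) (dg (f r))) ->
  hderiv (fun r => g (f r)) (fun r => df r * dg (f r)).
Proof.
  intros [Hf Hf'] Hg. split.
  - apply hcont_comp; [easy|]. intros r Hr. apply continuity_pt_filterlim.
    apply (ex_derive_continuous g). eexists; now apply Hg.
  - intros r Hr. apply (is_derive_comp g f); [apply Hg; lra|auto].
Qed.

Lemma hderiv_inv (f df : R -> R) :
  hderiv f df -> (forall r, 1 <= r -> f r <> 0) ->
  hderiv (fun r => / f r) (fun r => - df r * / f r * / f r).
Proof.
  intros Hf H0.
  eapply hderiv_ext; [| |apply (hderiv_comp Rinv f df (fun x => - / x ^ 2) Hf)].
  - reflexivity.
  - intros r Hr; simpl. field. apply H0; lra.
  - intros r Hr. auto_derive; [now apply H0|field; now apply H0].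
Qed.

Lemma hderiv_Rpower (f df : R -> R) (e : R) :
  hderiv f df -> (forall r, 1 <= r -> 0 < f r) ->
  hderiv (fun r => Rpower (f r) e) (fun r => e * Rpower (f r) e * / f r * df r).
Proof.
  intros Hf H0.
  eapply hderiv_ext;
    [| |apply (hderiv_comp (fun x => Rpower x e) f df
                 (fun x => e * Rpower x (e - 1)) Hf)].
  - reflexivity.
  - intros r Hr; simpl. assert (Hp : 0 < f r) by (apply H0; lra).
    replace (e - 1) with (e + - (1)) by ring.
    rewrite Rpower_plus, Rpower_Ropp, Rpower_1 by easy. ring.
  - intros r Hr. apply is_derive_Reals, derivable_pt_lim_power. now apply H0.
Qed.

Lemma hderiv_MVT (f df : R -> R) (a b : R) :
  hderiv f df -> 1 <= a <= b ->
  exists c, a <= c <= b /\ f b - f a = df c * (b - a).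
Proof.
  intros [Hc Hd] Hab.
  destruct (MVT_gen (fun s => f (Rmax 1 s)) a b df) as [c [H1 H2]].
  - rewrite Rmin_left, Rmax_right by lra. intros x Hx.
    apply (is_derive_ext_loc f); [|apply Hd; lra].
    apply (locally_gt 1); [lra|]. intros s Hs. now rewrite Rmax_right by lra.
  - intros x _. apply Hc.
  - exists c. rewrite Rmin_left, Rmax_right in H1 by lra.
    rewrite !Rmax_right in H2 by lra. now split.
Qed.

Lemma hderiv_nondecr (f df : R -> R) (a b : R) :
  hderiv f df -> (forall r, 1 < r -> 0 <= df r) -> 1 <= a <= b -> f a <= f b.
Proof.
  intros Hf Hp Hab.
  (* The intermediate point may be the endpoint 1, where nothing is known about [df]; the value 0
     there keeps the sign. *)
  pose (dg := fun r => if Rlt_dec 1 r then df r else 0).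
  assert (Hg : hderiv f dg).
  { apply (hderiv_ext f f df dg); auto. intros r Hr. unfold dg.
    destruct (Rlt_dec 1 r); lra. }
  destruct (hderiv_MVT f dg a b Hg Hab) as [c [Hc E]].
  assert (0 <= dg c) by (unfold dg; destruct (Rlt_dec 1 c); [now apply Hp|lra]).
  assert (0 <= dg c * (b - a)) by (apply Rmult_le_pos; lra). lra.
Qed.

Lemma hderiv_const_eq (f df : R -> R) (a : R) :
  hderiv f df -> (forall r, 1 < r -> df r = 0) -> 1 <= a -> f a = f 1.
Proof.
  intros Hf H0 Ha. apply Rle_antisym.
  - enough (- f 1 <= - f a) by lra.
    apply (hderiv_nondecr (fun r => - f r) (fun r => - df r)); [|intros r Hr; rewrite H0; lra|lra].
    eapply hderiv_ext; [| |apply (hderiv_scal (-1) _ _ Hf)]; intros; simpl; ring.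
  - apply (hderiv_nondecr f df); [easy|intros r Hr; rewrite H0; lra|lra].
Qed.

Lemma D_in_of_is_derive (f df : R -> R) (D : R -> Prop) (r : R) :
  is_derive f r (df r) -> D_in f df D r.
Proof.
  intros H. apply is_derive_Reals in H.
  intros eps Heps. destruct (H eps Heps) as [d Hd].
  exists d. split; [apply cond_pos|]. intros x [[Hx Hne] Hdist].
  simpl in *. unfold Rdist in *.
  specialize (Hd (x - r)). replace (r + (x - r)) with x in Hd by ring.
  apply Hd; [lra|easy].
Qed.

Lemma is_derive_of_D_in (f df : R -> R) (r : R) :
  1 < r -> D_in f df halfline r -> is_derive f r (df r).
Proof.
  intros Hr H. apply is_derive_Reals. intros eps Heps.
  destruct (H eps Heps) as [d [Hd H']].
  assert (Hm : 0 < Rmin d (r - 1)) by (apply Rmin_pos; lra).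
  exists (mkposreal _ Hm). intros h Hh0 Hh. simpl in *. unfold Rdist in *.
  assert (Rabs h < d) by (eapply Rlt_le_trans; [exact Hh|apply Rmin_l]).
  assert (Rabs h < r - 1) by (eapply Rlt_le_trans; [exact Hh|apply Rmin_r]).
  specialize (H' (r + h)). replace (r + h - r) with h in H' by ring.
  apply H'. repeat split; try easy; unfold halfline.
  - assert (- Rabs h <= h) by (rewrite <- Rabs_Ropp; pose proof (Rle_abs (- h)); lra). lra.
  - lra.
Qed.

Lemma hderiv_of_is_deriv_halfline (f df : R -> R) :
  is_deriv_halfline f df -> hderiv f df.
Proof.
  intros H. split.
  - intros r. destruct (Rlt_le_dec 1 r) as [Hr|Hr].
    + assert (C : continuity_pt f r).
      { apply continuity_pt_filterlim, (ex_derive_continuous f).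
        exists (df r). apply is_derive_of_D_in; [easy|apply H; lra]. }
      apply (continuity_pt_ext_loc f); [|easy].
      apply (locally_gt 1); [easy|]. intros s Hs. now rewrite Rmax_right by lra.
    (* This case also covers [r < 1]: the clamped function is constant there, and [x - 1 <= x - r]
       for [x > 1]. *)
    + assert (L : limit1_in f (D_x halfline 1) (f 1) 1)
        by (apply (cont_deriv f df halfline 1), H; lra).
      intros eps Heps. destruct (L eps Heps) as [d [Hd L']].
      exists d. split; [easy|]. intros x [_ Hx]. simpl in *. unfold Rdist in *.
      rewrite (Rmax_left 1 r) by easy.
      destruct (Rle_dec x 1) as [Hx1|Hx1].
      * rewrite Rmax_left by easy. rewrite Rminus_diag, Rabs_R0. easy.
      * rewrite Rmax_right by lra. apply L'. split; [unfold D_x, halfline; lra|].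
        rewrite Rabs_pos_eq by lra. rewrite Rabs_pos_eq in Hx by lra. lra.
  - intros r Hr. apply is_derive_of_D_in; [easy|apply H; lra].
Qed.

(** The mean value theorem writes the difference quotient at the endpoint as [df c] with
    [1 <= c <= x], which tends to [df 1] by continuity of [df]. This recovers the one-sided
    derivative that [hderiv] leaves out. *)
Lemma is_deriv_halfline_of_hderiv (f df : R -> R) :
  hderiv f df -> hcont df -> is_deriv_halfline f df.
Proof.
  intros Hf Hc r Hr. destruct (Req_dec r 1) as [->|Hr1].
  - intros eps Heps. destruct (Hc 1 eps Heps) as [d [Hd H]].
    exists d. split; [easy|]. intros x [[Hx Hne] Hdist]. unfold halfline in Hx.
    simpl in *. unfold Rdist in *.
    destruct (hderiv_MVT f df 1 x Hf) as [c [H1 H2]]; [lra|].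
    rewrite H2. replace (df c * (x - 1) / (x - 1)) with (df c) by (field; lra).
    destruct (Req_dec c 1) as [->|Hc1].
    + now rewrite Rminus_diag, Rabs_R0.
    + specialize (H c). rewrite Rmax_right, (Rmax_right 1 1) in H by lra.
      apply H. repeat split; [lra|].
      rewrite Rabs_pos_eq by lra. rewrite Rabs_pos_eq in Hdist by lra. lra.
  - apply D_in_of_is_derive, Hf. lra.
Qed.

(** The points [r + a / 2] make every [r >= 1] a limit point of the half-line, the endpoint
    included. This identifies the derivative named by the boundary condition, or by
    [decay_estimates], with that of the smooth solution. *)
Lemma D_in_halfline_unique (f d1 d2 : R -> R) (r : R) :
  1 <= r -> D_in f d1 halfline r -> D_in f d2 halfline r -> d1 r = d2 r.
Proof.
  intros Hr H1 H2. unfold D_in in *.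
  apply (single_limit _ _ _ _ _) with (2 := H1) (3 := H2).
  intros a Ha. exists (r + a / 2). repeat split.
  - unfold halfline; lra.
  - lra.
  - unfold Rdist. replace (r + a / 2 - r) with (a / 2) by ring.
    rewrite Rabs_pos_eq; lra.
Qed.

(** * Comparison and existence on the half-line *)

(** Completeness in the form of nested intervals. It yields a limit together with its error bound,
    for the tail integral in [hderiv_tail] and for the sequence in [geometric_limit]. *)
Lemma separation (I : Type) (i0 : I) (U V : I -> R) :
  (forall i j, U i <= V j) -> exists L, forall i, U i <= L <= V i.
Proof.
  intros H. destruct (completeness (fun x => exists i, x = U i)) as [L [H1 H2]].
  - exists (V i0). intros x [i ->]. apply H.
  - now exists (U i0), i0.
  - exists L. intros i. split.
    + apply H1. now exists i.
    + apply H2. intros x [j ->]. apply H.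
Qed.

Lemma hcont_primitive (g : R -> R) :
  hcont g -> exists J, hderiv J g /\ J 1 = 0.
Proof.
  intros Hg. pose (h := fun s => g (Rmax 1 s)).
  assert (Hh : forall r, continuous h r)
    by (intros r; apply continuity_pt_filterlim, Hg).
  exists (fun r => RInt h 1 r). split; [|exact (RInt_point 1 h)].
  apply hderiv_of_derive. intros r Hr.
  replace (g r) with (h r) by (unfold h; now rewrite Rmax_right).
  apply (is_derive_RInt h _ 1); [|apply Hh].
  apply filter_forall. intros x. apply (RInt_correct h), (ex_RInt_continuous h).
  intros; apply Hh.
Qed.

(** When [Phi] tends to 0, [J r] is minus the integral of [g] from [r] to infinity. No improper
    integral is formed: around a primitive [I], the intervals from [I r - Phi r] to [I r + Phi r]
    are nested as [r] grows, and a common point [L] acts as the value of [I] at infinity. *)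
Lemma hderiv_tail (g Phi dPhi : R -> R) :
  hcont g -> hderiv Phi dPhi -> (forall r, 1 <= r -> 0 <= Phi r) ->
  (forall r, 1 < r -> Rabs (g r) <= - dPhi r) ->
  exists J, hderiv J g /\ forall r, 1 <= r -> Rabs (J r) <= Phi r.
Proof.
  intros Hg HPhi Hpos Hle. destruct (hcont_primitive g Hg) as [I [HI _]].
  assert (Hlo : hderiv (fun r => I r - Phi r) (fun r => g r - dPhi r))
    by now apply hderiv_minus.
  assert (Hhi : hderiv (fun r => (-1) * (I r + Phi r))
                       (fun r => (-1) * (g r + dPhi r)))
    by now apply hderiv_scal, hderiv_plus.
  assert (B : forall r, 1 < r -> dPhi r <= g r <= - dPhi r).
  { intros r Hr. specialize (Hle r Hr). apply Rabs_le_between in Hle. lra. }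
  destruct (separation {r | 1 <= r} (exist _ 1 (Rle_refl 1))
              (fun r => I (proj1_sig r) - Phi (proj1_sig r))
              (fun r => I (proj1_sig r) + Phi (proj1_sig r))) as [L HL].
  - intros [a Ha] [b Hb]; simpl.
    pose proof (Hpos a Ha). pose proof (Hpos b Hb).
    destruct (Rle_dec a b) as [Hab|Hab].
    + assert (I a - Phi a <= I b - Phi b); [|lra].
      apply (hderiv_nondecr _ _ a b Hlo); [|lra].
      intros r Hr. specialize (B r Hr). lra.
    + assert ((-1) * (I b + Phi b) <= (-1) * (I a + Phi a)); [|lra].
      apply (hderiv_nondecr _ _ b a Hhi); [|lra].
      intros r Hr. specialize (B r Hr). lra.
  - exists (fun r => I r - L). split.
    + eapply hderiv_ext;
        [| |apply (hderiv_minus _ _ _ _ HI (hderiv_const L))];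
        intros; simpl; ring.
    + intros r Hr. specialize (HL (exist _ r Hr)). simpl in HL.
      apply Rabs_le. lra.
Qed.

Lemma hderiv_exp (c : R) : hderiv (fun r => exp (c * r)) (fun r => c * exp (c * r)).
Proof. apply hderiv_of_derive. intros r _. auto_derive; [easy|ring]. Qed.

Lemma exp_inv_cancel (c r : R) : exp (- c * r) * exp (c * r) = 1.
Proof. rewrite <- exp_plus, <- exp_0. f_equal. ring. Qed.

(** [Q r] is minus the integral of [exp (lam * (r - s)) * f s] over [s > r]; every other solution
    differs from it by a multiple of [exp (lam * r)] and is unbounded. *)
Lemma bounded_solution (lam K : R) (f : R -> R) :
  0 < lam -> hcont f -> (forall r, 1 <= r -> Rabs (f r) <= K) ->
  exists Q, hderiv Q (fun r => lam * Q r + f r) /\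
    forall r, 1 <= r -> Rabs (Q r) <= K / lam.
Proof.
  intros Hl Hf HK.
  assert (HK0 : 0 <= K)
    by (eapply Rle_trans; [apply Rabs_pos|apply (HK 1); lra]).
  destruct (hderiv_tail (fun r => exp (- lam * r) * f r)
     (fun r => K / lam * exp (- lam * r))
     (fun r => K / lam * (- lam * exp (- lam * r)))) as [J [HJ BJ]].
  - apply hcont_mult; [apply (hderiv_exp (- lam))|easy].
  - apply hderiv_scal, hderiv_exp.
  - intros r _. apply Rmult_le_pos; [apply Rdiv_le_0_compat; lra|].
    left; apply exp_pos.
  - intros r Hr. rewrite Rabs_mult, Rabs_pos_eq by (left; apply exp_pos).
    replace (- (K / lam * (- lam * exp (- lam * r))))
      with (exp (- lam * r) * K) by (field; lra).
    apply Rmult_le_compat_l; [left; apply exp_pos|apply HK; lra].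
  - exists (fun r => exp (lam * r) * J r). split.
    + eapply hderiv_ext; [| |apply (hderiv_mult _ _ _ _ (hderiv_exp lam) HJ)].
      * reflexivity.
      * intros r _. cbv beta.
        transitivity (lam * (exp (lam * r) * J r)
                      + exp (- lam * r) * exp (lam * r) * f r); [ring|].
        rewrite exp_inv_cancel. ring.
    + intros r Hr. rewrite Rabs_mult, Rabs_pos_eq by (left; apply exp_pos).
      replace (K / lam) with (K / lam * (exp (- lam * r) * exp (lam * r)))
        by (rewrite exp_inv_cancel; ring).
      rewrite (Rmult_comm (exp (lam * r))), <- Rmult_assoc.
      apply Rmult_le_compat_r; [left; apply exp_pos|now apply BJ].
Qed.

Lemma forward_solution (lam p1 : R) (f : R -> R) :
  hcont f -> exists P, hderiv P (fun r => - lam * P r + f r) /\ P 1 = p1.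
Proof.
  intros Hf.
  destruct (hcont_primitive (fun r => exp (lam * r) * f r)) as [J [HJ J1]].
  { apply hcont_mult; [apply (hderiv_exp lam)|easy]. }
  pose (c := p1 * exp (lam * 1)).
  exists (fun r => exp (- lam * r) * (c + J r)). split.
  - eapply hderiv_ext; [| |apply (hderiv_mult _ _ _ _ (hderiv_exp (- lam))
      (hderiv_plus _ _ _ _ (hderiv_const c) HJ))].
    + reflexivity.
    + intros r _. cbv beta.
      transitivity (- lam * (exp (- lam * r) * (c + J r))
                    + exp (- lam * r) * exp (lam * r) * f r); [ring|].
      rewrite exp_inv_cancel. ring.
  - rewrite J1. unfold c.
    transitivity (p1 * (exp (- lam * 1) * exp (lam * 1))); [ring|].
    rewrite exp_inv_cancel. ring.
Qed.

(* [exp (- lam r) X r] is nondecreasing, so a positive value of [X] would force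
   exponential growth. *)
Lemma bounded_nonpos (lam M : R) (X dX : R -> R) :
  0 < lam -> hderiv X dX -> (forall r, 1 < r -> lam * X r <= dX r) ->
  (forall r, 1 <= r -> X r <= M) -> forall r, 1 <= r -> X r <= 0.
Proof.
  intros Hl HX Hge HM r0 Hr0. apply Rnot_lt_le. intros Hpos.
  assert (H : forall r, r0 <= r -> exp (- lam * r0) * X r0 <= exp (- lam * r) * X r).
  { intros r Hr. apply (hderiv_nondecr _ _ r0 r
      (hderiv_mult _ _ _ _ (hderiv_exp (- lam)) HX)); [|lra].
    intros s Hs. specialize (Hge s Hs).
    replace (- lam * exp (- lam * s) * X s + exp (- lam * s) * dX s)
      with (exp (- lam * s) * (dX s - lam * X s)) by ring.
    apply Rmult_le_pos; [left; apply exp_pos|lra]. }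
  assert (HM0 : 0 < M) by (specialize (HM r0 Hr0); lra).
  pose (t := M / X r0 / lam).
  assert (Ht : 0 < t) by (unfold t; repeat apply Rdiv_lt_0_compat; easy).
  specialize (H (r0 + t)). specialize (HM (r0 + t)).
  assert (E : exp (- lam * r0) = exp (lam * t) * exp (- lam * (r0 + t)))
    by (rewrite <- exp_plus; f_equal; ring).
  rewrite E in H.
  assert (H' : exp (- lam * (r0 + t)) * (exp (lam * t) * X r0)
               <= exp (- lam * (r0 + t)) * X (r0 + t)) by lra.
  apply Rmult_le_reg_l in H'; [|apply exp_pos].
  assert (Hlt : 1 + lam * t < exp (lam * t)).
  { apply exp_ineq1. apply Rgt_not_eq, Rmult_gt_0_compat; lra. }
  assert (E2 : lam * t * X r0 = M) by (unfold t; field; lra).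
  assert ((1 + lam * t) * X r0 < exp (lam * t) * X r0)
    by (apply Rmult_lt_compat_r; lra).
  lra.
Qed.

(** Because [phi] decreases, [X = e * Q - K / lam * phi] with [e = 1] or [e = -1] satisfies
    [lam * X <= X'], and [bounded_nonpos] applies. The bound [M] only rules out exponential growth;
    its size does not enter the estimate. *)
Lemma bounded_comparison (lam K M : R) (Q dQ H phi dphi : R -> R) :
  0 < lam -> 0 <= K -> hderiv Q dQ ->
  (forall r, 1 < r -> dQ r = lam * Q r + H r) ->
  hderiv phi dphi -> (forall r, 1 < r -> dphi r <= 0) ->
  (forall r, 1 <= r -> 0 <= phi r) ->
  (forall r, 1 <= r -> Rabs (H r) <= K * phi r) ->
  (forall r, 1 <= r -> Rabs (Q r) <= M) ->
  forall r, 1 <= r -> Rabs (Q r) <= K / lam * phi r.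
Proof.
  intros Hl HK HQ EQ Hphi Hdec Hpos HH HM.
  assert (HKl : 0 <= K / lam) by (apply Rdiv_le_0_compat; lra).
  assert (G : forall e, e = 1 \/ e = -1 -> forall r, 1 <= r ->
    e * Q r - K / lam * phi r <= 0).
  { intros e He.
    apply (bounded_nonpos lam M _ _ Hl (hderiv_minus _ _ _ _
       (hderiv_scal e _ _ HQ) (hderiv_scal (K / lam) _ _ Hphi))).
    - intros r Hr. rewrite EQ by easy.
      assert (0 <= K / lam * - dphi r)
        by (specialize (Hdec r Hr); apply Rmult_le_pos; lra).
      assert (A : - (K * phi r) <= e * H r).
      { assert (B : Rabs (H r) <= K * phi r) by (apply HH; lra).
        apply Rabs_le_between in B. destruct He as [->| ->]; lra. }
      replace (lam * (e * Q r - K / lam * phi r))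
        with (lam * e * Q r - K * phi r) by (field; lra).
      lra.
    - intros r Hr. specialize (HM r Hr). apply Rabs_le_between in HM.
      assert (0 <= K / lam * phi r) by (apply Rmult_le_pos; auto).
      destruct He as [->| ->]; lra. }
  intros r Hr. apply Rabs_le.
  pose proof (G 1 (or_introl eq_refl) r Hr).
  pose proof (G (-1) (or_intror eq_refl) r Hr). lra.
Qed.

(** With [c = K / (lam - eps)], [c * phi] is a supersolution: [c * phi' + lam * c * phi >= c * (lam
    - eps) * phi = K * phi]. The loss [eps] is the rate at which the weight itself decays.
    Multiplying by [exp (lam * r)] turns this into monotonicity. *)
Lemma forward_comparison (lam eps K : R) (P dP H phi dphi : R -> R) :
  0 <= K -> eps < lam -> hderiv P dP ->
  (forall r, 1 < r -> dP r = - lam * P r + H r) ->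
  hderiv phi dphi -> (forall r, 1 < r -> - (eps * phi r) <= dphi r) ->
  (forall r, 1 <= r -> Rabs (H r) <= K * phi r) ->
  Rabs (P 1) <= K / (lam - eps) * phi 1 ->
  forall r, 1 <= r -> Rabs (P r) <= K / (lam - eps) * phi r.
Proof.
  intros HK Heps HP EP Hphi Hdec HH H1.
  set (c := K / (lam - eps)) in *.
  assert (Hc : 0 <= c) by (apply Rdiv_le_0_compat; lra).
  assert (EK : K = c * (lam - eps)) by (unfold c; field; lra).
  assert (G : forall e, e = 1 \/ e = -1 -> forall r, 1 <= r ->
    e * P r - c * phi r <= 0).
  { intros e He r Hr.
    pose proof (hderiv_minus _ _ _ _
       (hderiv_scal e _ _ HP) (hderiv_scal c _ _ Hphi)) as HX.
    pose proof (hderiv_scal (-1) _ _ (hderiv_mult _ _ _ _ (hderiv_exp lam) HX)) as HE.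
    assert (A : -1 * (exp (lam * 1) * (e * P 1 - c * phi 1)) <=
                -1 * (exp (lam * r) * (e * P r - c * phi r))).
    { apply (hderiv_nondecr _ _ 1 r HE); [|lra].
      intros s Hs. rewrite EP by easy.
      match goal with |- 0 <= ?x =>
        replace x with (exp (lam * s) * (- (e * H s) + c * dphi s + lam * c * phi s))
          by ring end.
      apply Rmult_le_pos; [left; apply exp_pos|].
      assert (A1 : e * H s <= K * phi s).
      { assert (B : Rabs (H s) <= K * phi s) by (apply HH; lra).
        apply Rabs_le_between in B. destruct He as [->| ->]; lra. }
      assert (A2 : c * - (eps * phi s) <= c * dphi s)
        by (apply Rmult_le_compat_l; auto).
      rewrite EK in A1. lra. }
    assert (A1 : e * P 1 - c * phi 1 <= 0).
    { apply Rabs_le_between in H1. destruct He as [->| ->]; lra. }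
    apply Rnot_lt_le. intros Hn.
    pose proof (Rmult_lt_0_compat _ _ (exp_pos (lam * r)) Hn).
    assert (0 <= exp (lam * 1) * - (e * P 1 - c * phi 1))
      by (apply Rmult_le_pos; [left; apply exp_pos|lra]).
    lra. }
  intros r Hr. apply Rabs_le.
  pose proof (G 1 (or_introl eq_refl) r Hr).
  pose proof (G (-1) (or_intror eq_refl) r Hr). lra.
Qed.

(** Both [X - Phi] and [- X - Phi] are nondecreasing with limit 0, hence nonpositive. *)
Lemma tail_comparison (X dX Phi dPhi : R -> R) :
  hderiv X dX -> hderiv Phi dPhi ->
  (forall r, 1 < r -> Rabs (dX r) <= - dPhi r) ->
  is_lim X p_infty 0 -> is_lim Phi p_infty 0 ->
  forall r, 1 <= r -> Rabs (X r) <= Phi r.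
Proof.
  intros HX HPhi Hle LX LPhi.
  assert (G : forall e, e = 1 \/ e = -1 -> forall r, 1 <= r ->
    e * X r - Phi r <= 0).
  { intros e He r Hr.
    assert (L : is_lim (fun s => e * X s - Phi s) p_infty (Finite (e * 0 - 0))).
    { apply is_lim_minus'; [|easy]. apply (is_lim_scal_l X e p_infty 0 LX). }
    assert (A : Rbar_le (e * X r - Phi r) (e * 0 - 0)).
    { apply (is_lim_le_loc (fun _ => e * X r - Phi r)
               (fun s => e * X s - Phi s) p_infty); [|apply is_lim_const|easy].
      exists r. intros s Hs.
      apply (hderiv_nondecr _ _ r s (hderiv_minus _ _ _ _
       (hderiv_scal e _ _ HX) HPhi)); [|lra].
      intros t Ht. specialize (Hle t Ht). apply Rabs_le_between in Hle.
      destruct He as [->| ->]; lra. }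
    simpl in A. lra. }
  intros r Hr. apply Rabs_le.
  pose proof (G 1 (or_introl eq_refl) r Hr).
  pose proof (G (-1) (or_intror eq_refl) r Hr). lra.
Qed.

(** * Geometric convergence and an abstract fixed point *)

Lemma geometric_bound_zero (theta a c : R) :
  0 <= theta < 1 -> (forall k, Rabs a <= c * theta ^ k) -> a = 0.
Proof.
  intros Ht H.
  assert (L : is_lim_seq (fun k => c * theta ^ k) (c * 0)).
  { apply (is_lim_seq_scal_l _ c 0), is_lim_seq_geom.
    rewrite Rabs_pos_eq; lra. }
  assert (A : Rbar_le (Rabs a) (c * 0))
    by (apply (is_lim_seq_le _ _ _ _ H (is_lim_seq_const _) L)).
  simpl in A. rewrite Rmult_0_r in A.
  apply Rabs_eq_0. pose proof (Rabs_pos a). lra.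
Qed.

Lemma geometric_limit (theta c : R) (x : nat -> R) :
  0 <= theta < 1 -> 0 <= c ->
  (forall k, Rabs (x (S k) - x k) <= c * theta ^ k) ->
  exists l, forall k, Rabs (x k - l) <= c / (1 - theta) * theta ^ k.
Proof.
  (* [b] is the value with [b * theta ^ k - b * theta ^ (k + 1) = c * theta ^ k], so the intervals
     of radius [b * theta ^ k] around [x k] are nested. *)
  intros Ht Hc H. set (b := c / (1 - theta)).
  assert (Eb : c = b * (1 - theta)) by (unfold b; field; lra).
  assert (Hb : 0 <= b) by (apply Rdiv_le_0_compat; lra).
  assert (Hp : forall k, 0 <= b * theta ^ k)
    by (intros; apply Rmult_le_pos; [easy|apply pow_le; lra]).
  assert (Hinc : forall k, x k - b * theta ^ k <= x (S k) - b * theta ^ S k /\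
                 x (S k) + b * theta ^ S k <= x k + b * theta ^ k).
  { intros k. specialize (H k). rewrite Eb in H. apply Rabs_le_between in H.
    simpl. lra. }
  assert (Hmono : forall i j, x i - b * theta ^ i <= x (j + i)%nat - b * theta ^ (j + i) /\
                 x (j + i)%nat + b * theta ^ (j + i) <= x i + b * theta ^ i).
  { intros i j. induction j as [|j IH]; [simpl; lra|].
    destruct (Hinc (j + i)%nat). simpl Nat.add. lra. }
  destruct (separation nat 0%nat (fun k => x k - b * theta ^ k)
              (fun k => x k + b * theta ^ k)) as [L HL].
  - intros i j. destruct (Nat.le_ge_cases i j) as [Hij|Hij].
    + destruct (Hmono i (j - i)%nat) as [A _].
      replace (j - i + i)%nat with j in A by lia. specialize (Hp j). lra.
    + destruct (Hmono j (i - j)%nat) as [_ A].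
      replace (i - j + j)%nat with i in A by lia. specialize (Hp i). lra.
  - exists L. intros k. specialize (HL k). apply Rabs_le. lra.
Qed.

(* [step] is a relation because the image of a state is only known to exist. *)
Lemma contraction_fixed_point (X : Type) (W : X -> R)
    (K : (X -> R) -> Prop) (step : (X -> R) -> (X -> R) -> Prop) (theta D : R) :
  0 <= theta < 1 -> 0 <= D -> (forall x, 0 <= W x) ->
  (exists s, K s) ->
  (forall s, K s -> exists s', K s' /\ step s s') ->
  (forall s1 s2, K s1 -> K s2 -> forall x, Rabs (s1 x - s2 x) <= D * W x) ->
  (forall s1 s2 s1' s2' d, 0 <= d -> K s1 -> K s2 -> K s1' -> K s2' ->
    step s1 s1' -> step s2 s2' ->
    (forall x, Rabs (s1 x - s2 x) <= d * W x) ->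
    forall x, Rabs (s1' x - s2' x) <= theta * d * W x) ->
  (forall (sk : nat -> X -> R) s c, 0 <= c -> (forall k, K (sk k)) ->
    (forall k x, Rabs (sk k x - s x) <= c * theta ^ k * W x) -> K s) ->
  exists s s', K s /\ K s' /\ step s s' /\ forall x, s' x = s x.
Proof.
  intros Ht HD HW [s0 Hs0] Hstep Hdiam Hcontr Hclosed.
  destruct (functional_choice
    (fun s s' : {s | K s} => step (proj1_sig s) (proj1_sig s'))) as [T HT].
  { intros [s Hs]. destruct (Hstep s Hs) as [s' [Hs' Hss']].
    now exists (exist _ s' Hs'). }
  pose (it := fix it k := match k with O => exist _ s0 Hs0 | S k => T (it k) end).
  pose (sk := fun k => proj1_sig (it k)).
  assert (HK : forall k, K (sk k)) by (intros k; apply (proj2_sig (it k))).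
  assert (Hs : forall k, step (sk k) (sk (S k))) by (intros k; apply HT).
  assert (Hp : forall k, 0 <= D * theta ^ k)
    by (intros; apply Rmult_le_pos; [easy|apply pow_le; lra]).
  assert (Hd : forall k x, Rabs (sk (S k) x - sk k x) <= D * theta ^ k * W x).
  { induction k as [|k IH]; intros x.
    - rewrite pow_O, Rmult_1_r. now apply Hdiam.
    - replace (D * theta ^ S k) with (theta * (D * theta ^ k)) by (simpl; ring).
      now apply (Hcontr (sk (S k)) (sk k)). }
  set (c := D / (1 - theta)).
  assert (Hc : 0 <= c) by (apply Rdiv_le_0_compat; lra).
  destruct (functional_choice
    (fun x l => forall k, Rabs (sk k x - l) <= c * theta ^ k * W x)) as [s Hlim].
  { intros x. destruct (geometric_limit theta (D * W x) (fun k => sk k x)) as [l Hl].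
    - easy.
    - apply Rmult_le_pos; auto.
    - intros k. specialize (Hd k x). lra.
    - exists l. intros k. specialize (Hl k). unfold c.
      replace (D / (1 - theta) * theta ^ k * W x)
        with (D * W x / (1 - theta) * theta ^ k) by (field; lra). easy. }
  assert (Ks : K s) by (apply (Hclosed sk s c); auto).
  destruct (Hstep s Ks) as [s' [Ks' Hss']].
  exists s, s'. repeat split; try easy. intros x.
  (* The image [s'] of the limit could a priori differ from [s], but the iterate [sk (S k)] is
     within a multiple of [theta ^ k] of both: of [s] by convergence, of [s'] by contraction. *)
  apply Rminus_diag_uniq.
  apply (geometric_bound_zero theta _ (2 * theta * c * W x)); [easy|].
  intros k.
  assert (A : Rabs (sk (S k) x - s' x) <= theta * (c * theta ^ k) * W x).
  { apply (Hcontr (sk k) s (sk (S k)) s'); auto.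
    apply Rmult_le_pos; [easy|apply pow_le; lra]. }
  pose proof (Hlim x (S k)) as B. simpl in B.
  replace (s' x - s x) with ((sk (S k) x - s x) - (sk (S k) x - s' x)) by ring.
  eapply Rle_trans; [apply Rabs_triang|]. rewrite Rabs_Ropp. lra.
Qed.

(** * Coefficients and weights *)

(* [codim] is the paper's n - 1. *)
Record coeffs := Coeffs
  { codim : nat; gam : R; visc : R; capil : R; rho_inf : R }.

Definition admissible (c : coeffs) : Prop :=
  (1 <= codim c)%nat /\ 1 <= gam c /\ 0 < visc c /\ 0 < capil c /\ 0 < rho_inf c.

Definition NN (c : coeffs) : R := INR (codim c).

(* P'(rho) / rho for P(rho) = rho^gam, the derivative of the enthalpy. *)
Definition enth' (c : coeffs) (x : R) : R := gam c * Rpower x (gam c - 2).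

(** Linearised at [rho_inf] and without curvature, the equation is [w'' = alpha w]. *)
Definition alpha (c : coeffs) : R := enth' c (rho_inf c) / capil c.
Definition lam (c : coeffs) : R := alpha c + NN c + 1.
Definition shift (c : coeffs) : R := 4 * lam c * (2 * NN c + 1) / alpha c.

(* [shift] makes the weight [phi] vary slowly compared with [exp (- lam r)]
   while keeping it equivalent to r^-(2n-1). *)
Definition phi (c : coeffs) (r : R) : R := / (r + shift c) ^ (2 * codim c + 1).
(** The integral of [phi] from [r] to infinity: a bound on the slope by [phi] becomes a bound on the
    density by [Phi]. *)
Definition Phi (c : coeffs) (r : R) : R :=
  / (2 * NN c) * / (r + shift c) ^ (2 * codim c).

(* The momentum equation divided by [capil * rho] and solved for the third
   derivative of [rho], with [w], [v] the first two derivatives and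
   u = m / (rho r^(n-1)), is [v' = lam^2 w + source]. *)
Definition nonlin (c : coeffs) (m r x w v : R) : R :=
  / capil c *
  ((enth' c x - enth' c (rho_inf c)) * w
   - m ^ 2 * (w * (/ x) ^ 3 * (/ r ^ codim c) ^ 2
              + NN c * (/ x) ^ 2 * ((/ r ^ codim c) ^ 2 * / r))
   + visc c * m * (v * (/ x) ^ 3 * / r ^ codim c
                   - 2 * w ^ 2 * (/ x) ^ 4 * / r ^ codim c
                   - NN c * w * (/ x) ^ 3 * (/ r ^ codim c * / r))).

Definition source (c : coeffs) (m r x w v : R) : R :=
  - (lam c ^ 2 - alpha c - NN c * (/ r) ^ 2) * w - NN c * / r * v
  + nonlin c m r x w v.

Lemma NN_ge1 c : admissible c -> 1 <= NN c.
Proof. intros (H & _). apply (le_INR 1) in H. exact H. Qed.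

Lemma enth'_pos c x : admissible c -> 0 < enth' c x.
Proof.
  intros (_ & H & _). apply Rmult_lt_0_compat; [lra|apply exp_pos].
Qed.

Lemma alpha_pos c : admissible c -> 0 < alpha c.
Proof.
  intros H. apply Rdiv_lt_0_compat; [now apply enth'_pos|apply H].
Qed.

Lemma lam_ge1 c : admissible c -> 1 <= lam c.
Proof.
  intros H. pose proof (alpha_pos c H). pose proof (NN_ge1 c H). unfold lam. lra.
Qed.

(** In [lam^2 = lam * alpha + lam * NN + lam] the three terms dominate [alpha], [NN * lam / r] and
    [NN / r^2] in turn; this fixes the choice of [lam]. The point is that the coefficient of [w] in
    [source] beats [lam] times that of [v]. *)
Lemma lam_dominates c r : admissible c -> 1 <= r ->
  0 <= NN c * / r * lam c <= lam c ^ 2 - alpha c - NN c * (/ r) ^ 2.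
Proof.
  intros H Hr. pose proof (alpha_pos c H) as Ha. pose proof (NN_ge1 c H) as HN.
  pose proof (lam_ge1 c H) as Hl.
  assert (Hi : 0 < / r <= 1).
  { split; [apply Rinv_0_lt_compat; lra|]. rewrite <- Rinv_1.
    apply Rinv_le_contravar; lra. }
  assert (A : NN c * / r * lam c <= NN c * lam c).
  { rewrite Rmult_assoc. apply Rmult_le_compat_l; [lra|].
    rewrite <- (Rmult_1_l (lam c)) at 2. apply Rmult_le_compat_r; lra. }
  assert (B : NN c * (/ r) ^ 2 <= NN c).
  { rewrite <- (Rmult_1_r (NN c)) at 2. apply Rmult_le_compat_l; [lra|].
    rewrite <- (pow1 2). apply pow_incr. lra. }
  split.
  - apply Rmult_le_pos; [apply Rmult_le_pos|]; lra.
  - assert (lam c ^ 2 = lam c * alpha c + lam c * NN c + lam c)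
      by (unfold lam; ring).
    assert (alpha c <= lam c * alpha c).
    { rewrite <- (Rmult_1_l (alpha c)) at 1. apply Rmult_le_compat_r; lra. }
    assert (NN c <= lam c) by (unfold lam; lra).
    lra.
Qed.

Lemma shift_pos c : admissible c -> 0 < shift c.
Proof.
  intros H. pose proof (alpha_pos c H). pose proof (NN_ge1 c H).
  pose proof (lam_ge1 c H). apply Rdiv_lt_0_compat; [|easy].
  apply Rmult_lt_0_compat; lra.
Qed.

Lemma phi_pos c r : admissible c -> 1 <= r -> 0 < phi c r.
Proof.
  intros H Hr. pose proof (shift_pos c H).
  apply Rinv_0_lt_compat, pow_lt. lra.
Qed.

Lemma Phi_pos c r : admissible c -> 1 <= r -> 0 < Phi c r.
Proof.
  intros H Hr. pose proof (shift_pos c H). pose proof (NN_ge1 c H).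
  apply Rmult_lt_0_compat; apply Rinv_0_lt_compat; [lra|apply pow_lt; lra].
Qed.

Lemma phi_le c r : admissible c -> 1 <= r -> phi c r <= / r ^ (2 * codim c + 1).
Proof.
  intros H Hr. pose proof (shift_pos c H).
  apply Rinv_le_contravar; [apply pow_lt; lra|apply pow_incr; lra].
Qed.

Lemma Phi_le c r : admissible c -> 1 <= r -> Phi c r <= / r ^ (2 * codim c).
Proof.
  intros H Hr. pose proof (shift_pos c H). pose proof (NN_ge1 c H).
  unfold Phi. rewrite <- (Rmult_1_l (/ r ^ (2 * codim c))).
  apply Rmult_le_compat.
  - left; apply Rinv_0_lt_compat; lra.
  - left; apply Rinv_0_lt_compat, pow_lt; lra.
  - rewrite <- Rinv_1. apply Rinv_le_contravar; lra.
  - apply Rinv_le_contravar; [apply pow_lt; lra|apply pow_incr; lra].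
Qed.

Lemma inv_pow_le1 r j : 1 <= r -> 0 < / r ^ j <= 1.
Proof.
  intros Hr. split; [apply Rinv_0_lt_compat, pow_lt; lra|].
  rewrite <- Rinv_1. apply Rinv_le_contravar; [lra|now apply pow_R1_Rle].
Qed.

Lemma phi_le1 c r : admissible c -> 1 <= r -> phi c r <= 1.
Proof.
  intros H Hr. eapply Rle_trans; [now apply phi_le|now apply inv_pow_le1].
Qed.

Lemma Phi_le1 c r : admissible c -> 1 <= r -> Phi c r <= 1.
Proof.
  intros H Hr. eapply Rle_trans; [now apply Phi_le|now apply inv_pow_le1].
Qed.

(** For [r >= 1], [r + shift <= (1 + shift) * r], so the shift costs only a constant factor. *)
Lemma inv_pow_le_phi c r : admissible c -> 1 <= r ->
  / r ^ (2 * codim c + 1) <= (1 + shift c) ^ (2 * codim c + 1) * phi c r.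
Proof.
  intros H Hr. pose proof (shift_pos c H). unfold phi.
  set (j := (2 * codim c + 1)%nat).
  assert (Hp : 0 < r ^ j) by (apply pow_lt; lra).
  assert (Hq : 0 < (r + shift c) ^ j) by (apply pow_lt; lra).
  assert (A : (r + shift c) ^ j <= (1 + shift c) ^ j * r ^ j).
  { rewrite <- Rpow_mult_distr. apply pow_incr. split; [lra|].
    assert (shift c * 1 <= shift c * r) by (apply Rmult_le_compat_l; lra). lra. }
  apply (Rmult_le_reg_r (r ^ j * (r + shift c) ^ j)).
  - now apply Rmult_lt_0_compat.
  - replace (/ r ^ j * (r ^ j * (r + shift c) ^ j)) with ((r + shift c) ^ j)
      by (field; lra).
    replace ((1 + shift c) ^ j * / (r + shift c) ^ j * (r ^ j * (r + shift c) ^ j))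
      with ((1 + shift c) ^ j * r ^ j) by (field; lra).
    easy.
Qed.

Lemma hderiv_phi c : admissible c ->
  hderiv (phi c) (fun r => - (2 * NN c + 1) * / (r + shift c) * phi c r).
Proof.
  intros H. pose proof (shift_pos c H). apply hderiv_of_derive. intros r Hr.
  unfold phi, NN.
  assert (E : INR (2 * codim c + 1) = 2 * INR (codim c) + 1)
    by (rewrite plus_INR, mult_INR; simpl; ring).
  rewrite <- E. replace (2 * codim c + 1)%nat with (S (2 * codim c)) by lia.
  set (j := (2 * codim c)%nat). clearbody j. auto_derive.
  - apply (pow_nonzero _ (S j)). lra.
  - change (match j with 0%nat => 1 | S _ => INR j + 1 end) with (INR (S j)).
    simpl pow. field.
    repeat split; first [lra|apply pow_nonzero; lra].
Qed.

Lemma hderiv_Phi c : admissible c -> hderiv (Phi c) (fun r => - phi c r).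
Proof.
  intros H. pose proof (shift_pos c H). pose proof (NN_ge1 c H) as HN.
  apply hderiv_of_derive. intros r Hr. unfold NN in HN.
  unfold Phi, phi, NN.
  assert (E : INR (2 * codim c) = 2 * INR (codim c))
    by (rewrite mult_INR; simpl; ring).
  rewrite <- E in *. replace (2 * codim c + 1)%nat with (S (2 * codim c)) by lia.
  destruct H as [Hk _].
  replace (2 * codim c)%nat with (S (2 * codim c - 1)) in * by lia.
  assert (HE : INR (S (2 * codim c - 1)) <> 0) by (apply not_0_INR; lia).
  set (j := (2 * codim c - 1)%nat) in *. clearbody j. auto_derive.
  - apply (pow_nonzero _ (S j)). lra.
  - change (match j with 0%nat => 1 | S _ => INR j + 1 end) with (INR (S j)) in *.
    simpl pow. field.
    repeat split; first [assumption|lra|apply pow_nonzero; lra].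
Qed.

(** The two inequalities serve the two directions of integration: [phi] decreases, for the backward
    comparison, but no faster than at rate [alpha / (4 * lam)], for the forward one. [shift] is the
    value for which [(2 * NN + 1) / shift] is this rate. *)
Lemma phi_slow c r : admissible c -> 1 <= r ->
  - (alpha c / (4 * lam c) * phi c r)
  <= - (2 * NN c + 1) * / (r + shift c) * phi c r <= 0.
Proof.
  intros H Hr. pose proof (shift_pos c H) as Hs. pose proof (NN_ge1 c H) as HN.
  pose proof (phi_pos c r H Hr) as Hp. pose proof (alpha_pos c H) as Ha.
  pose proof (lam_ge1 c H) as Hl.
  assert (A : 0 < / (r + shift c) <= / shift c).
  { split; [apply Rinv_0_lt_compat; lra|apply Rinv_le_contravar; lra]. }
  assert (E : alpha c / (4 * lam c) = (2 * NN c + 1) * / shift c)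
    by (unfold shift; field; lra).
  rewrite E.
  assert (B : 0 <= (2 * NN c + 1) * / (r + shift c) <= (2 * NN c + 1) * / shift c).
  { split; [apply Rmult_le_pos; lra|apply Rmult_le_compat_l; lra]. }
  assert (C : 0 <= (2 * NN c + 1) * / (r + shift c) * phi c r)
    by (apply Rmult_le_pos; lra).
  assert (D : (2 * NN c + 1) * / (r + shift c) * phi c r
              <= (2 * NN c + 1) * / shift c * phi c r)
    by (apply Rmult_le_compat_r; lra).
  lra.
Qed.

Lemma is_lim_Phi c : admissible c -> is_lim (Phi c) p_infty 0.
Proof.
  intros H.
  apply (is_lim_le_le_loc (fun _ => 0) (fun r => / r)).
  - exists 1. intros r Hr. split; [left; apply Phi_pos; [easy|lra]|].
    eapply Rle_trans; [apply Phi_le; [easy|lra]|].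
    destruct H as [Hk _]. apply Rinv_le_contravar; [lra|].
    rewrite <- (pow_1 r) at 1. apply Rle_pow; [lra|lia].
  - apply is_lim_const.
  - replace (Finite 0) with (Rbar_inv p_infty) by easy.
    apply (is_lim_inv (fun r => r) p_infty p_infty); [apply is_lim_id|easy].
Qed.

(** * Bounds near the rest density and their composition *)

(** The exponents in use, [gam - 2] and [gam - 3], can have either sign, so [ln x] is bounded
    through both ends of the interval instead of by monotonicity of the power. *)
Lemma Rabs_Rpower_le (x lo hi e : R) : 0 < lo -> lo <= x <= hi ->
  Rabs (Rpower x e) <= exp (Rabs e * (Rabs (ln lo) + Rabs (ln hi))).
Proof.
  intros Hlo Hx. unfold Rpower. rewrite Rabs_pos_eq by (left; apply exp_pos).
  assert (B : Rabs (ln x) <= Rabs (ln lo) + Rabs (ln hi)).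
  { assert (ln lo <= ln x) by (apply ln_le; lra).
    assert (ln x <= ln hi) by (apply ln_le; lra).
    pose proof (Rle_abs (ln hi)). pose proof (Rle_abs (- ln lo)).
    rewrite Rabs_Ropp in *. pose proof (Rabs_pos (ln hi)).
    pose proof (Rabs_pos (ln lo)). apply Rabs_le. lra. }
  assert (A : e * ln x <= Rabs e * (Rabs (ln lo) + Rabs (ln hi))).
  { eapply Rle_trans; [apply Rle_abs|]. rewrite Rabs_mult.
    apply Rmult_le_compat_l; [apply Rabs_pos|easy]. }
  destruct A as [A|A]; [left; now apply exp_increasing|rewrite A; lra].
Qed.

Lemma enth'_lipschitz c : admissible c -> exists L, 0 <= L /\
  forall x y, Rabs (x - rho_inf c) <= rho_inf c / 2 ->
    Rabs (y - rho_inf c) <= rho_inf c / 2 ->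
    Rabs (enth' c x - enth' c y) <= L * Rabs (x - y).
Proof.
  intros (_ & Hg & _ & _ & Hr).
  set (b := exp (Rabs (gam c - 3) *
     (Rabs (ln (rho_inf c / 2)) + Rabs (ln (2 * rho_inf c))))).
  exists (Rabs (gam c * (gam c - 2)) * b). split.
  { apply Rmult_le_pos; [apply Rabs_pos|left; apply exp_pos]. }
  intros x y Hx Hy. apply Rabs_le_between in Hx. apply Rabs_le_between in Hy.
  destruct (MVT_gen (enth' c) y x
    (fun z => gam c * ((gam c - 2) * Rpower z (gam c - 2 - 1)))) as [z [Hz E]].
  - intros z Hz. apply is_derive_scal.
    apply is_derive_Reals, derivable_pt_lim_power.
    pose proof (Rmin_glb y x (rho_inf c / 2)). lra.
  - intros z Hz. apply continuity_pt_filterlim, (ex_derive_continuous (enth' c)).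
    exists (gam c * ((gam c - 2) * Rpower z (gam c - 2 - 1))).
    apply is_derive_scal, is_derive_Reals, derivable_pt_lim_power.
    pose proof (Rmin_glb y x (rho_inf c / 2)). lra.
  - rewrite E, Rabs_mult. apply Rmult_le_compat_r; [apply Rabs_pos|].
    rewrite <- Rmult_assoc, Rabs_mult. apply Rmult_le_compat_l; [apply Rabs_pos|].
    replace (gam c - 2 - 1) with (gam c - 3) by ring.
    apply Rabs_Rpower_le; [lra|].
    pose proof (Rmin_glb y x (rho_inf c / 2)).
    pose proof (Rmax_lub y x (2 * rho_inf c)). lra.
Qed.

(** One constant is both the size bound and the Lipschitz constant, so estimates compose along sums
    and products and the constant of a long expression follows from its structure. *)
Definition bounded_lip (b d x y : R) : Prop :=
  Rabs x <= b /\ Rabs y <= b /\ Rabs (x - y) <= b * d.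

Lemma bounded_lip_const b d x : 0 <= d -> Rabs x <= b -> bounded_lip b d x x.
Proof.
  intros Hd Hx. repeat split; try easy. rewrite Rminus_diag, Rabs_R0.
  apply Rmult_le_pos; [|easy]. pose proof (Rabs_pos x). lra.
Qed.

Lemma bounded_lip_plus b b' d x y x' y' :
  bounded_lip b d x y -> bounded_lip b' d x' y' ->
  bounded_lip (b + b') d (x + x') (y + y').
Proof.
  intros (A & B & C) (A' & B' & C'). repeat split.
  - eapply Rle_trans; [apply Rabs_triang|lra].
  - eapply Rle_trans; [apply Rabs_triang|lra].
  - replace (x + x' - (y + y')) with ((x - y) + (x' - y')) by ring.
    eapply Rle_trans; [apply Rabs_triang|lra].
Qed.

Lemma bounded_lip_minus b b' d x y x' y' :
  bounded_lip b d x y -> bounded_lip b' d x' y' ->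
  bounded_lip (b + b') d (x - x') (y - y').
Proof.
  intros H (A & B & C). apply (bounded_lip_plus b b' d x y (- x') (- y')); [easy|].
  repeat split; rewrite ?Rabs_Ropp; try easy.
  replace (- x' - - y') with (- (x' - y')) by ring. now rewrite Rabs_Ropp.
Qed.

Lemma bounded_lip_mult b b' d x y x' y' :
  bounded_lip b d x y -> bounded_lip b' d x' y' ->
  bounded_lip (2 * (b * b')) d (x * x') (y * y').
Proof.
  intros (A & B & C) (A' & B' & C').
  assert (P : forall s t, Rabs s <= b -> Rabs t <= b' -> Rabs (s * t) <= b * b').
  { intros s t Hs Ht. rewrite Rabs_mult.
    apply Rmult_le_compat; try easy; apply Rabs_pos. }
  assert (Q : 0 <= b * b').
  { apply Rmult_le_pos; [pose proof (Rabs_pos x)|pose proof (Rabs_pos x')]; lra. }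
  repeat split.
  - specialize (P x x' A A'). lra.
  - specialize (P y y' B B'). lra.
  - replace (x * x' - y * y') with ((x - y) * x' + y * (x' - y')) by ring.
    eapply Rle_trans; [apply Rabs_triang|]. rewrite !Rabs_mult.
    assert (Rabs (x - y) * Rabs x' <= (b * d) * b')
      by (apply Rmult_le_compat; try easy; apply Rabs_pos).
    assert (Rabs y * Rabs (x' - y') <= b * (b' * d))
      by (apply Rmult_le_compat; try easy; apply Rabs_pos).
    lra.
Qed.

Lemma bounded_lip_inv R0 d x y : 0 < R0 -> Rabs (x - R0) <= R0 / 2 ->
  Rabs (y - R0) <= R0 / 2 -> Rabs (x - y) <= d ->
  bounded_lip (2 / R0 + 4 / R0 ^ 2) d (/ x) (/ y).
Proof.
  intros HR Hx Hy Hd. apply Rabs_le_between in Hx. apply Rabs_le_between in Hy.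
  assert (I : forall z, R0 / 2 <= z -> 0 < / z <= 2 / R0).
  { intros z Hz. split; [apply Rinv_0_lt_compat; lra|].
    replace (2 / R0) with (/ (R0 / 2)) by (field; lra).
    apply Rinv_le_contravar; lra. }
  assert (Ix : 0 < / x <= 2 / R0) by (apply I; lra).
  assert (Iy : 0 < / y <= 2 / R0) by (apply I; lra).
  assert (S4 : 0 < 4 / R0 ^ 2) by (apply Rdiv_lt_0_compat; [|apply pow_lt]; lra).
  repeat split.
  - rewrite Rabs_pos_eq; lra.
  - rewrite Rabs_pos_eq; lra.
  - replace (/ x - / y) with (- (/ x * / y) * (x - y)) by (field; lra).
    rewrite Rabs_mult, Rabs_Ropp, (Rabs_pos_eq (/ x * / y))
      by (apply Rmult_le_pos; lra).
    assert (/ x * / y <= 4 / R0 ^ 2).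
    { replace (4 / R0 ^ 2) with ((2 / R0) * (2 / R0)) by (field; lra).
      apply Rmult_le_compat; lra. }
    apply Rmult_le_compat; try lra; [apply Rmult_le_pos; lra|apply Rabs_pos].
Qed.

Lemma bounded_lip_weaken b b' d x y :
  b <= b' -> 0 <= d -> bounded_lip b d x y -> bounded_lip b' d x y.
Proof.
  intros Hb Hd (A & B & C). repeat split; try lra.
  assert (b * d <= b' * d) by now apply Rmult_le_compat_r. lra.
Qed.

(** * Lipschitz estimates for the source *)

(* After dividing [w], [v] by [phi], every term of [nonlin] except the enthalpy
   one carries a factor [u]. *)
Definition nonlin_rescaled (c : coeffs) (u f a b e M y w v : R) : R :=
  visc c * (M * (v * (y * y * y) * a
                 - 2 * f * (w * w) * (y * y * y * y) * a
                 - NN c * w * (y * y * y) * (a * b)))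
  - u * (M * M * (w * (y * y * y) * (a * a) + NN c * (y * y) * e)).

Lemma nonlin_rescaledE c u r x M w v f : f <> 0 ->
  nonlin c (M * u) r x (f * w) (f * v) =
  f * / capil c * ((enth' c x - enth' c (rho_inf c)) * w
    + u * nonlin_rescaled c u f (/ r ^ codim c) (/ r)
            ((/ r ^ codim c) ^ 2 * / r / f) M (/ x) w v).
Proof.
  intros Hf. unfold nonlin, nonlin_rescaled.
  set (a := / r ^ codim c). set (b := / r). set (y := / x). set (k := / capil c).
  field. easy.
Qed.

Lemma nonlin_rescaled_lipschitz c : admissible c -> exists K, 0 <= K /\
  forall u d r x1 x2 M1 M2 w1 w2 v1 v2,
  1 <= r -> Rabs u <= 1 -> 0 <= d ->
  Rabs (x1 - rho_inf c) <= rho_inf c / 2 ->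
  Rabs (x2 - rho_inf c) <= rho_inf c / 2 ->
  Rabs (x1 - x2) <= d ->
  Rabs (M1 - rho_inf c) <= rho_inf c / 2 ->
  Rabs (M2 - rho_inf c) <= rho_inf c / 2 ->
  Rabs (M1 - M2) <= d ->
  bounded_lip 1 d w1 w2 -> bounded_lip 1 d v1 v2 ->
  bounded_lip K d
    (nonlin_rescaled c u (phi c r) (/ r ^ codim c) (/ r)
      ((/ r ^ codim c) ^ 2 * / r / phi c r) M1 (/ x1) w1 v1)
    (nonlin_rescaled c u (phi c r) (/ r ^ codim c) (/ r)
      ((/ r ^ codim c) ^ 2 * / r / phi c r) M2 (/ x2) w2 v2).
Proof.
  intros H.
  match goal with |- exists K, _ /\ @?P K => assert (G : exists K, P K) end.
  (* The constant stays open and is assembled by the composition rules from the bounds of the atoms;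
     opening it before the variables makes it independent of the point and of the states. *)
  { eexists. intros u d r x1 x2 M1 M2 w1 w2 v1 v2 Hr Hu Hd Hx1 Hx2 Hx HM1 HM2 HM Hw Hv.
    assert (HR : 0 < rho_inf c) by apply H.
    assert (BM : bounded_lip (1 + 2 * rho_inf c) d M1 M2).
    { apply Rabs_le_between in HM1. apply Rabs_le_between in HM2.
      repeat split; try (apply Rabs_le; lra).
      eapply Rle_trans; [exact HM|].
      assert (0 <= 2 * rho_inf c * d) by (apply Rmult_le_pos; lra). lra. }
    assert (By : bounded_lip (2 / rho_inf c + 4 / rho_inf c ^ 2) d (/ x1) (/ x2))
      by now apply bounded_lip_inv.
    assert (Bu : bounded_lip 1 d u u) by now apply bounded_lip_const.
    assert (Ba : bounded_lip 1 d (/ r ^ codim c) (/ r ^ codim c)).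
    { apply bounded_lip_const; [easy|]. destruct (inv_pow_le1 r (codim c) Hr).
      rewrite Rabs_pos_eq; lra. }
    assert (Bb : bounded_lip 1 d (/ r) (/ r)).
    { apply bounded_lip_const; [easy|]. destruct (inv_pow_le1 r 1 Hr) as [A B].
      rewrite pow_1 in A, B. rewrite Rabs_pos_eq; lra. }
    assert (Bf : bounded_lip 1 d (phi c r) (phi c r)).
    { apply bounded_lip_const; [easy|]. rewrite Rabs_pos_eq.
      - now apply phi_le1.
      - left; now apply phi_pos. }
    assert (Be : bounded_lip ((1 + shift c) ^ (2 * codim c + 1)) d
      ((/ r ^ codim c) ^ 2 * / r / phi c r) ((/ r ^ codim c) ^ 2 * / r / phi c r)).
    { apply bounded_lip_const; [easy|].
      pose proof (phi_pos c r H Hr) as Hp.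
      replace ((/ r ^ codim c) ^ 2 * / r) with (/ r ^ (2 * codim c + 1)).
      - destruct (inv_pow_le1 r (2 * codim c + 1) Hr).
        rewrite Rabs_pos_eq by (left; now apply Rdiv_lt_0_compat).
        apply Rle_div_l; [easy|]. now apply inv_pow_le_phi.
      - rewrite pow_add, pow_1, Rinv_mult. f_equal.
        now rewrite Nat.mul_comm, pow_mult, pow_inv. }
    assert (Bc : forall z, bounded_lip (Rabs z) d z z)
      by (intros z; apply bounded_lip_const; [easy|apply Rle_refl]).
    unfold nonlin_rescaled.
    repeat first [ eassumption | apply bounded_lip_minus | apply bounded_lip_plus
      | apply bounded_lip_mult | apply Bc ].  }
  (* The sign of the assembled constant is not tracked, hence the maximum with 0. *)
  destruct G as [K HK]. exists (Rmax 0 K). split; [apply Rmax_l|].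
  intros. apply (bounded_lip_weaken K); [apply Rmax_r|easy|now apply HK].
Qed.

(** The enthalpy term is quadratic in the deviation from rest, which gives the factor [B]; all other
    terms carry [u]. A hypothesis [bounded_lip (B * phi c r) 0 w1 w1] is just the bound of [w1] by
    [B * phi c r]. *)
Lemma nonlin_lipschitz c : admissible c -> exists K, 0 <= K /\
  forall u B d r x1 x2 M1 M2 w1 w2 v1 v2,
  1 <= r -> Rabs u <= 1 -> 0 <= B <= 1 -> 0 <= d ->
  Rabs (x1 - rho_inf c) <= B -> Rabs (x2 - rho_inf c) <= B ->
  Rabs (x1 - rho_inf c) <= rho_inf c / 2 ->
  Rabs (x2 - rho_inf c) <= rho_inf c / 2 ->
  Rabs (x1 - x2) <= d ->
  Rabs (M1 - rho_inf c) <= rho_inf c / 2 ->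
  Rabs (M2 - rho_inf c) <= rho_inf c / 2 ->
  Rabs (M1 - M2) <= d ->
  bounded_lip (B * phi c r) 0 w1 w1 -> bounded_lip (B * phi c r) 0 w2 w2 ->
  bounded_lip (B * phi c r) 0 v1 v1 -> bounded_lip (B * phi c r) 0 v2 v2 ->
  Rabs (w1 - w2) <= d * phi c r -> Rabs (v1 - v2) <= d * phi c r ->
  Rabs (nonlin c (M1 * u) r x1 w1 v1 - nonlin c (M2 * u) r x2 w2 v2)
    <= K * (B + Rabs u) * (d * phi c r).
Proof.
  intros H. destruct (nonlin_rescaled_lipschitz c H) as [K [HK HT]].
  destruct (enth'_lipschitz c H) as [L [HL HLip]].
  assert (Hk : 0 < / capil c) by (apply Rinv_0_lt_compat, H).
  exists (/ capil c * (2 * L + K)). split; [apply Rmult_le_pos; lra|].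
  intros u B d r x1 x2 M1 M2 w1 w2 v1 v2 Hr Hu HB Hd HB1 HB2 Hx1 Hx2 Hx
    HM1 HM2 HM [Hw1 _] [Hw2 _] [Hv1 _] [Hv2 _] Hw Hv.
  pose proof (phi_pos c r H Hr) as Hp. set (f := phi c r) in *.
  assert (Sc : forall z b, Rabs z <= b * f -> Rabs (z / f) <= b).
  { intros z b Hz. unfold Rdiv. rewrite Rabs_mult, (Rabs_pos_eq (/ f))
      by (left; now apply Rinv_0_lt_compat). now apply Rle_div_l. }
  assert (Sd : forall z z', Rabs (z - z') <= d * f -> Rabs (z / f - z' / f) <= d).
  { intros z z' Hz. replace (z / f - z' / f) with ((z - z') / f) by (field; lra).
    now apply Sc. }
  replace w1 with (f * (w1 / f)) by (field; lra).
  replace w2 with (f * (w2 / f)) by (field; lra).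
  replace v1 with (f * (v1 / f)) by (field; lra).
  replace v2 with (f * (v2 / f)) by (field; lra).
  apply Sc in Hw1, Hw2, Hv1, Hv2. apply Sd in Hw, Hv.
  rewrite !nonlin_rescaledE by lra.
  specialize (HT u d r x1 x2 M1 M2 (w1 / f) (w2 / f) (v1 / f) (v2 / f) Hr Hu Hd
    Hx1 Hx2 Hx HM1 HM2 HM ltac:(repeat split; lra) ltac:(repeat split; lra)).
  destruct HT as (_ & _ & HT). fold f in HT.
  match type of HT with Rabs (?a - ?b) <= _ => set (T1 := a) in *; set (T2 := b) in * end.
  set (o1 := w1 / f) in *. set (o2 := w2 / f) in *.
  pose proof (HLip x1 (rho_inf c) Hx1 ltac:(rewrite Rminus_diag, Rabs_R0; destruct H; lra)) as A1.
  pose proof (HLip x1 x2 Hx1 Hx2) as A2.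
  set (g1 := enth' c x1) in *. set (g2 := enth' c x2) in *.
  set (g0 := enth' c (rho_inf c)) in *.
  replace (f * / capil c * ((g1 - g0) * o1 + u * T1)
           - f * / capil c * ((g2 - g0) * o2 + u * T2))
    with (f * / capil c * ((g1 - g0) * (o1 - o2) + (g1 - g2) * o2 + u * (T1 - T2)))
    by ring.
  rewrite Rabs_mult, Rabs_pos_eq by (apply Rmult_le_pos; lra).
  replace (/ capil c * (2 * L + K) * (B + Rabs u) * (d * f))
    with (f * / capil c * ((2 * L + K) * (B + Rabs u) * d)) by ring.
  apply Rmult_le_compat_l; [apply Rmult_le_pos; lra|].
  eapply Rle_trans; [apply Rabs_triang|].
  eapply Rle_trans; [apply Rplus_le_compat_r, Rabs_triang|].
  rewrite !Rabs_mult.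
  assert (LB : L * Rabs (x1 - rho_inf c) <= L * B) by (apply Rmult_le_compat_l; lra).
  assert (Ld : L * Rabs (x1 - x2) <= L * d) by (apply Rmult_le_compat_l; lra).
  assert (C1 : Rabs (g1 - g0) * Rabs (o1 - o2) <= L * B * d)
    by (apply Rmult_le_compat; try apply Rabs_pos; lra).
  assert (C2 : Rabs (g1 - g2) * Rabs o2 <= L * d * B)
    by (apply Rmult_le_compat; try apply Rabs_pos; lra).
  assert (C3 : Rabs u * Rabs (T1 - T2) <= Rabs u * (K * d))
    by (apply Rmult_le_compat_l; [apply Rabs_pos|lra]).
  assert (C4 : 0 <= L * Rabs u * d)
    by (repeat apply Rmult_le_pos; try apply Rabs_pos; lra).
  assert (C5 : 0 <= K * B * d) by (repeat apply Rmult_le_pos; lra).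
  lra.
Qed.

(** With [a = lam^2 - alpha - NN / r^2] and [e = NN / r], the coefficients of [p] and [q] are
    [(a / lam - e) / 2] and [- (a / lam + e) / 2]. By [lam_dominates] the first is nonnegative, so
    their absolute values add up to [a / lam] and [e] cancels. *)
Lemma linear_part_bound c r p q b : admissible c -> 1 <= r ->
  Rabs p <= b -> Rabs q <= b ->
  Rabs (- (lam c ^ 2 - alpha c - NN c * (/ r) ^ 2) * ((q - p) / (2 * lam c))
        - NN c * / r * ((q + p) / 2)) <= (lam c - alpha c / lam c) * b.
Proof.
  intros H Hr Hp Hq. pose proof (lam_dominates c r H Hr) as A.
  pose proof (lam_ge1 c H) as Hl. pose proof (NN_ge1 c H) as HN.
  assert (Hb : 0 <= b) by (pose proof (Rabs_pos p); lra).
  set (a := lam c ^ 2 - alpha c - NN c * (/ r) ^ 2) in *.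
  set (e := NN c * / r) in *.
  assert (Hil : 0 < / lam c) by (apply Rinv_0_lt_compat; lra).
  assert (Ea : e <= a / lam c).
  { apply (Rmult_le_reg_r (lam c)); [lra|].
    unfold Rdiv. rewrite (Rmult_assoc a), Rinv_l; lra. }
  assert (He : 0 <= e).
  { apply (Rmult_le_reg_r (lam c)); lra. }
  replace (- a * ((q - p) / (2 * lam c)) - e * ((q + p) / 2))
    with ((a / lam c - e) / 2 * p - (a / lam c + e) / 2 * q) by (field; lra).
  eapply Rle_trans; [apply Rabs_triang|].
  rewrite Rabs_Ropp, !Rabs_mult, (Rabs_pos_eq ((a / lam c - e) / 2)),
    (Rabs_pos_eq ((a / lam c + e) / 2)) by lra.
  assert ((a / lam c - e) / 2 * Rabs p <= (a / lam c - e) / 2 * b)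
    by (apply Rmult_le_compat_l; lra).
  assert ((a / lam c + e) / 2 * Rabs q <= (a / lam c + e) / 2 * b)
    by (apply Rmult_le_compat_l; lra).
  assert (a / lam c <= lam c - alpha c / lam c).
  { replace (lam c - alpha c / lam c) with ((lam c ^ 2 - alpha c) / lam c)
      by (field; lra).
    apply Rmult_le_compat_r; [lra|]. unfold a.
    assert (0 <= NN c * (/ r) ^ 2); [|lra].
    apply Rmult_le_pos; [lra|]. apply pow_le. left; apply Rinv_0_lt_compat; lra. }
  assert (a / lam c * b <= (lam c - alpha c / lam c) * b)
    by (apply Rmult_le_compat_r; lra).
  lra.
Qed.

Lemma half_diff_bound l p q b : 1 <= l -> Rabs p <= b -> Rabs q <= b ->
  Rabs ((q - p) / (2 * l)) <= b / l.
Proof.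
  intros Hl Hp Hq.
  replace ((q - p) / (2 * l)) with ((q - p) / 2 * / l) by (field; lra).
  assert (0 < / l) by (apply Rinv_0_lt_compat; lra).
  rewrite Rabs_mult, (Rabs_pos_eq (/ l)) by lra.
  apply Rmult_le_compat_r; [lra|].
  apply Rabs_le_between in Hp. apply Rabs_le_between in Hq. apply Rabs_le; lra.
Qed.

Lemma half_sum_bound p q b : Rabs p <= b -> Rabs q <= b -> Rabs ((q + p) / 2) <= b.
Proof.
  intros Hp Hq. apply Rabs_le_between in Hp. apply Rabs_le_between in Hq.
  apply Rabs_le; lra.
Qed.

Lemma div_ge1_le b l : 0 <= b -> 1 <= l -> b / l <= b.
Proof.
  intros Hb Hl. apply Rle_div_l; [lra|].
  rewrite <- (Rmult_1_r b) at 1. apply Rmult_le_compat_l; lra.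
Qed.

(* The coefficient [lam - alpha / lam], less than [lam], is what makes the
   stationary problem a contraction. *)
Lemma source_lipschitz c : admissible c -> exists K, 0 <= K /\
  forall u B d r x1 x2 M1 M2 p1 p2 q1 q2,
  1 <= r -> Rabs u <= 1 -> 0 <= B <= 1 -> B <= rho_inf c / 2 -> 0 <= d ->
  Rabs (x1 - rho_inf c) <= B -> Rabs (x2 - rho_inf c) <= B ->
  Rabs (x1 - x2) <= d ->
  Rabs (M1 - rho_inf c) <= B -> Rabs (M2 - rho_inf c) <= B ->
  Rabs (M1 - M2) <= d ->
  Rabs p1 <= B * phi c r -> Rabs p2 <= B * phi c r ->
  Rabs q1 <= B * phi c r -> Rabs q2 <= B * phi c r ->
  Rabs (p1 - p2) <= d * phi c r -> Rabs (q1 - q2) <= d * phi c r ->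
  Rabs (source c (M1 * u) r x1 ((q1 - p1) / (2 * lam c)) ((q1 + p1) / 2)
        - source c (M2 * u) r x2 ((q2 - p2) / (2 * lam c)) ((q2 + p2) / 2))
    <= (lam c - alpha c / lam c + K * (B + Rabs u)) * d * phi c r.
Proof.
  intros H. destruct (nonlin_lipschitz c H) as [K [HK HN]].
  exists K. split; [easy|].
  intros u B d r x1 x2 M1 M2 p1 p2 q1 q2 Hr Hu HB HBr Hd Hx1 Hx2 Hx HM1 HM2 HM
    Hp1 Hp2 Hq1 Hq2 Hp Hq.
  pose proof (lam_ge1 c H) as Hl. pose proof (phi_pos c r H Hr) as Hf.
  assert (HBf : 0 <= B * phi c r) by (apply Rmult_le_pos; lra).
  assert (Hdf : 0 <= d * phi c r) by (apply Rmult_le_pos; lra).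
  assert (Bw : forall p q, Rabs p <= B * phi c r -> Rabs q <= B * phi c r ->
     bounded_lip (B * phi c r) 0 ((q - p) / (2 * lam c)) ((q - p) / (2 * lam c))).
  { intros p q Hp' Hq'. apply bounded_lip_const; [lra|].
    eapply Rle_trans; [apply half_diff_bound; eassumption|now apply div_ge1_le]. }
  assert (Bv : forall p q, Rabs p <= B * phi c r -> Rabs q <= B * phi c r ->
     bounded_lip (B * phi c r) 0 ((q + p) / 2) ((q + p) / 2)).
  { intros p q Hp' Hq'. apply bounded_lip_const; [lra|now apply half_sum_bound]. }
  assert (C1 := HN u B d r x1 x2 M1 M2 _ _ _ _ Hr Hu HB Hd Hx1 Hx2
    ltac:(lra) ltac:(lra) Hx ltac:(lra) ltac:(lra) HM
    (Bw _ _ Hp1 Hq1) (Bw _ _ Hp2 Hq2) (Bv _ _ Hp1 Hq1) (Bv _ _ Hp2 Hq2)).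
  pose proof (linear_part_bound c r (p1 - p2) (q1 - q2) (d * phi c r) H Hr Hp Hq) as C2.
  assert (D1 : Rabs ((q1 - p1) / (2 * lam c) - (q2 - p2) / (2 * lam c)) <= d * phi c r).
  { replace ((q1 - p1) / (2 * lam c) - (q2 - p2) / (2 * lam c))
      with (((q1 - q2) - (p1 - p2)) / (2 * lam c)) by (field; lra).
    eapply Rle_trans; [apply half_diff_bound; eassumption|now apply div_ge1_le]. }
  assert (D2 : Rabs ((q1 + p1) / 2 - (q2 + p2) / 2) <= d * phi c r).
  { replace ((q1 + p1) / 2 - (q2 + p2) / 2)
      with (((q1 - q2) + (p1 - p2)) / 2) by field.
    now apply half_sum_bound. }
  specialize (C1 D1 D2). unfold source.
  match type of C1 with Rabs (?a - ?b) <= _ => set (n1 := a) in *; set (n2 := b) in * end.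
  match type of C2 with Rabs ?a <= _ => set (l := a) in * end.
  match goal with |- Rabs ?a <= _ => replace a with (l + (n1 - n2)) end.
  - eapply Rle_trans; [apply Rabs_triang|]. lra.
  - unfold l. field. lra.
Qed.

(** At the rest state only the geometric part of the convective term survives; [rho_inf] cancels and
    a multiple of [u^2 / r ^ (2 * codim + 1)] remains. Hence the quadratic dependence on [u_-] and
    the power in the weight. *)
Lemma source_rest_bound c : admissible c -> exists K, 0 <= K /\
  forall u r, 1 <= r ->
    Rabs (source c (rho_inf c * u) r (rho_inf c) 0 0) <= K * Rabs u ^ 2 * phi c r.
Proof.
  intros H. set (S := (1 + shift c) ^ (2 * codim c + 1)).
  pose proof (shift_pos c H) as Hs. pose proof (NN_ge1 c H) as HN.
  assert (Hc : 0 < capil c) by apply H. assert (HR : 0 < rho_inf c) by apply H.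
  assert (0 < / capil c) by now apply Rinv_0_lt_compat.
  assert (HS : 0 <= S) by (apply pow_le; lra).
  exists (/ capil c * NN c * S). split; [repeat apply Rmult_le_pos; lra|].
  intros u r Hr.
  assert (E : source c (rho_inf c * u) r (rho_inf c) 0 0
     = - (/ capil c * NN c * u ^ 2 * / r ^ (2 * codim c + 1))).
  { unfold source, nonlin.
    replace (/ r ^ (2 * codim c + 1)) with ((/ r ^ codim c) ^ 2 * / r).
    - set (a := / r ^ codim c). set (b := / r). field. lra.
    - rewrite pow_add, pow_1, Rinv_mult. f_equal.
      now rewrite Nat.mul_comm, pow_mult, pow_inv. }
  rewrite E, Rabs_Ropp, pow2_abs. rewrite Rabs_pos_eq.
  - pose proof (inv_pow_le_phi c r H Hr) as A. fold S in A.
    replace (/ capil c * NN c * S * u ^ 2 * phi c r)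
      with (/ capil c * NN c * u ^ 2 * (S * phi c r)) by ring.
    apply Rmult_le_compat_l; [|easy].
    apply Rmult_le_pos; [apply Rmult_le_pos; lra|apply pow2_ge_0].
  - destruct (inv_pow_le1 r (2 * codim c + 1) Hr).
    apply Rmult_le_pos; [|lra].
    apply Rmult_le_pos; [apply Rmult_le_pos; lra|apply pow2_ge_0].
Qed.

(** * The contraction *)

(** The mass flux is [x 1 * u]: since the boundary density is not prescribed, the source depends on
    the unknown nonlocally. *)
Definition source_along (c : coeffs) (u : R) (x p q : R -> R) (r : R) : R :=
  source c (x 1 * u) r (x r) ((q r - p r) / (2 * lam c)) ((q r + p r) / 2).

(* [p] and [q] stand for v - lam w and v + lam w. *)
Definition step (c : coeffs) (u rb : R) (x p q x' p' q' : R -> R) : Prop :=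
  hderiv p' (fun r => - lam c * p' r + source_along c u x p q r) /\
  hderiv q' (fun r => lam c * q' r + source_along c u x p q r) /\
  hderiv x' (fun r => (q' r - p' r) / (2 * lam c)) /\
  p' 1 = q' 1 - 2 * lam c * rb.

(** The slope [(q - p) / (2 * lam)] is at most [B / lam * phi]; integrated from infinity, this gives
    the radius used for the density. *)
Definition in_ball (c : coeffs) (B : R) (x p q : R -> R) : Prop :=
  (hcont x /\ hcont p /\ hcont q) /\
  forall r, 1 <= r ->
    Rabs (x r - rho_inf c) <= B / lam c * Phi c r /\
    Rabs (p r) <= B * phi c r /\ Rabs (q r) <= B * phi c r.

Definition state_close (c : coeffs) (d : R) (x1 p1 q1 x2 p2 q2 : R -> R) : Prop :=
  forall r, 1 <= r ->
    Rabs (x1 r - x2 r) <= d / lam c * Phi c r /\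
    Rabs (p1 r - p2 r) <= d * phi c r /\ Rabs (q1 r - q2 r) <= d * phi c r.

(** A quarter of the gain [alpha / lam]. The nonlinear terms use one, so the source has Lipschitz
    constant [lam - 3 * slack]; the weight uses another, so the forward solution divides by
    [lam - slack]. The quotient is [rate]. *)
Definition slack (c : coeffs) : R := alpha c / (4 * lam c).

Definition rate (c : coeffs) : R := (lam c - 3 * slack c) / (lam c - slack c).

Lemma slack_pos c : admissible c -> 0 < slack c.
Proof.
  intros H. pose proof (alpha_pos c H). pose proof (lam_ge1 c H).
  apply Rdiv_lt_0_compat; lra.
Qed.

Lemma slack_lt c : admissible c -> 4 * slack c < lam c.
Proof.
  intros H. pose proof (alpha_pos c H). pose proof (lam_ge1 c H).
  pose proof (NN_ge1 c H).
  replace (4 * slack c) with (alpha c / lam c) by (unfold slack; field; lra).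
  apply Rle_lt_trans with (alpha c); [apply div_ge1_le; lra|unfold lam; lra].
Qed.

Lemma rate_bounds c : admissible c -> 0 <= rate c < 1.
Proof.
  intros H. pose proof (slack_pos c H). pose proof (slack_lt c H). split.
  - apply Rdiv_le_0_compat; lra.
  - apply Rlt_div_l; lra.
Qed.

Lemma Phi_scaled_le c B r : admissible c -> 0 <= B -> 1 <= r ->
  B / lam c * Phi c r <= B.
Proof.
  intros H HB Hr. pose proof (lam_ge1 c H). pose proof (Phi_le1 c r H Hr).
  pose proof (Phi_pos c r H Hr).
  assert (0 <= B / lam c <= B)
    by (split; [apply Rdiv_le_0_compat; lra|apply div_ge1_le; lra]).
  rewrite <- (Rmult_1_r B) at 2. apply Rmult_le_compat; lra.
Qed.

Lemma source_along_close c : admissible c -> exists K, 0 <= K /\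
  forall u B d x1 p1 q1 x2 p2 q2,
  Rabs u <= 1 -> 0 <= B <= 1 -> B <= rho_inf c / 2 -> 0 <= d ->
  K * (B + Rabs u) <= slack c ->
  in_ball c B x1 p1 q1 -> in_ball c B x2 p2 q2 ->
  state_close c d x1 p1 q1 x2 p2 q2 ->
  forall r, 1 <= r ->
  Rabs (source_along c u x1 p1 q1 r - source_along c u x2 p2 q2 r)
    <= (lam c - 3 * slack c) * d * phi c r.
Proof.
  intros H. destruct (source_lipschitz c H) as [K [HK HL]].
  exists K. split; [easy|].
  intros u B d x1 p1 q1 x2 p2 q2 Hu HB HBr Hd Hs [_ H1] [_ H2] Hw r Hr.
  destruct (H1 r Hr) as (A1 & A2 & A3). destruct (H2 r Hr) as (B1 & B2 & B3).
  destruct (Hw r Hr) as (C1 & C2 & C3).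
  destruct (H1 1 (Rle_refl 1)) as (A0 & _). destruct (H2 1 (Rle_refl 1)) as (B0 & _).
  destruct (Hw 1 (Rle_refl 1)) as (C0 & _).
  pose proof (Phi_scaled_le c B r H ltac:(lra) Hr).
  pose proof (Phi_scaled_le c B 1 H ltac:(lra) ltac:(lra)).
  pose proof (Phi_scaled_le c d r H Hd Hr).
  pose proof (Phi_scaled_le c d 1 H Hd ltac:(lra)).
  eapply Rle_trans.
  - apply (HL u B d r (x1 r) (x2 r) (x1 1) (x2 1) (p1 r) (p2 r) (q1 r) (q2 r));
      try assumption; lra.
  - pose proof (phi_pos c r H Hr). pose proof (lam_ge1 c H).
    apply Rmult_le_compat_r; [lra|]. apply Rmult_le_compat_r; [lra|].
    replace (alpha c / lam c) with (4 * slack c) by (unfold slack; field; lra).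
    lra.
Qed.

Lemma hcont_Rpower (f : R -> R) e :
  hcont f -> (forall r, 1 <= r -> 0 < f r) -> hcont (fun r => Rpower (f r) e).
Proof.
  intros Hf Hp. apply (hcont_comp (fun x => Rpower x e)); [easy|].
  intros r Hr. apply derivable_continuous_pt. eexists.
  apply derivable_pt_lim_power. now apply Hp.
Qed.

Lemma hcont_pow (f : R -> R) j : hcont f -> hcont (fun r => f r ^ j).
Proof.
  intros Hf. induction j as [|j IH]; simpl.
  - apply hcont_const.
  - now apply hcont_mult.
Qed.

Lemma hcont_opp (f : R -> R) : hcont f -> hcont (fun r => - f r).
Proof. intros Hf r. exact (continuity_pt_opp _ r (Hf r)). Qed.

Lemma hcont_source c m (x w v : R -> R) :
  hcont x -> hcont w -> hcont v -> (forall r, 1 <= r -> 0 < x r) ->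
  hcont (fun r => source c m r (x r) (w r) (v r)).
Proof.
  intros Hx Hw Hv Hp.
  assert (Hi : hcont (fun r => / x r)).
  { apply hcont_inv; [easy|]. intros r Hr. specialize (Hp r Hr). lra. }
  assert (Hr : hcont (fun r => / r)) by (apply hcont_inv; [apply hcont_id|intros; lra]).
  assert (Hk : hcont (fun r => / r ^ codim c)).
  { apply hcont_inv; [apply hcont_pow, hcont_id|].
    intros r Hr1. apply pow_nonzero. lra. }
  assert (Hg : hcont (fun r => enth' c (x r)))
    by (apply hcont_mult; [apply hcont_const|now apply hcont_Rpower]).
  unfold source, nonlin.
  repeat first [ assumption | apply hcont_plus | apply hcont_minus
    | apply hcont_mult | apply hcont_opp | apply hcont_pow | apply hcont_const ].
Qed.

Lemma in_ball_pos c B x p q : admissible c -> 0 <= B <= rho_inf c / 2 ->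
  in_ball c B x p q -> forall r, 1 <= r -> 0 < x r.
Proof.
  intros H HB [_ Hb] r Hr. destruct (Hb r Hr) as [A _].
  pose proof (Phi_scaled_le c B r H ltac:(lra) Hr).
  apply Rabs_le_between in A. assert (0 < rho_inf c) by apply H. lra.
Qed.

Lemma hcont_source_along c u B x p q : admissible c -> 0 <= B <= rho_inf c / 2 ->
  in_ball c B x p q -> hcont (source_along c u x p q).
Proof.
  intros H HB Hb. pose proof (in_ball_pos c B x p q H HB Hb) as Hp.
  destruct Hb as [(Hx & Hcp & Hq) _].
  apply hcont_source; try easy.
  - apply (hcont_mult _ (fun _ => / (2 * lam c)));
      [now apply hcont_minus|apply hcont_const].
  - apply (hcont_mult _ (fun _ => / 2)); [now apply hcont_plus|apply hcont_const].
Qed.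

Lemma is_lim_of_Phi_bound c B (x : R -> R) l : admissible c ->
  (forall r, 1 <= r -> Rabs (x r - l) <= B * Phi c r) -> is_lim x p_infty l.
Proof.
  intros H Hb.
  assert (L : forall e, is_lim (fun r => l + e * (B * Phi c r)) p_infty l).
  { intros e. replace (Finite l) with (Finite (l + e * (B * 0))) by (f_equal; ring).
    apply is_lim_plus'; [apply is_lim_const|].
    apply (is_lim_scal_l _ e p_infty (B * 0)).
    apply (is_lim_scal_l _ B p_infty 0). now apply is_lim_Phi. }
  apply (is_lim_le_le_loc (fun r => l + (-1) * (B * Phi c r))
           (fun r => l + 1 * (B * Phi c r))); [|apply L|apply L].
  exists 1. intros r Hr. specialize (Hb r ltac:(lra)).
  apply Rabs_le_between in Hb. lra.
Qed.

(** The boundary data dictate the order: [q'] comes first, as it is determined by boundedness at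
    infinity; its value at 1 then bounds that of [p'], where [rb] cancels in the difference; the
    density follows by integration from infinity. *)
Lemma step_contracts c : admissible c -> exists K, 0 <= K /\
  forall u rb B d x1 p1 q1 x2 p2 q2 x1' p1' q1' x2' p2' q2',
  Rabs u <= 1 -> 0 <= B <= 1 -> B <= rho_inf c / 2 -> 0 <= d ->
  K * (B + Rabs u) <= slack c ->
  in_ball c B x1 p1 q1 -> in_ball c B x2 p2 q2 ->
  in_ball c B x1' p1' q1' -> in_ball c B x2' p2' q2' ->
  step c u rb x1 p1 q1 x1' p1' q1' -> step c u rb x2 p2 q2 x2' p2' q2' ->
  state_close c d x1 p1 q1 x2 p2 q2 ->
  state_close c (rate c * d) x1' p1' q1' x2' p2' q2'.
Proof.
  intros H. destruct (source_along_close c H) as [K [HK HS]].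
  exists K. split; [easy|].
  intros u rb B d x1 p1 q1 x2 p2 q2 x1' p1' q1' x2' p2' q2' Hu HB HBr Hd Hs
    Hb1 Hb2 [_ Hb1'] [_ Hb2'] (P1 & Q1 & X1 & I1) (P2 & Q2 & X2 & I2) Hw.
  specialize (HS u B d _ _ _ _ _ _ Hu HB HBr Hd Hs Hb1 Hb2 Hw).
  set (S1 := source_along c u x1 p1 q1) in *.
  set (S2 := source_along c u x2 p2 q2) in *.
  pose proof (lam_ge1 c H) as Hl. pose proof (slack_pos c H) as Hsp.
  pose proof (slack_lt c H) as Hsl.
  set (b := lam c - 3 * slack c) in *.
  assert (Hbd : 0 <= b * d) by (unfold b; apply Rmult_le_pos; lra).
  assert (Er : rate c * d = b * d / (lam c - slack c))
    by (unfold rate, b; field; lra).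
  pose proof (hderiv_minus _ _ _ _ P1 P2) as HP.
  pose proof (hderiv_minus _ _ _ _ Q1 Q2) as HQ.
  pose proof (hderiv_minus _ _ _ _ X1 X2) as HX.
  assert (Hi : / lam c <= / (lam c - slack c)) by (apply Rinv_le_contravar; lra).
  assert (BQ0 : forall r, 1 <= r -> Rabs (q1' r - q2' r) <= b * d / lam c * phi c r).
  { apply (bounded_comparison (lam c) (b * d) (2 * B) (fun r => q1' r - q2' r) _
      (fun r => S1 r - S2 r) (phi c) _ ltac:(lra) Hbd HQ) with (2 := hderiv_phi c H).
    - intros r _. ring.
    - intros r Hr. apply (phi_slow c r H). lra.
    - intros r Hr. left; now apply phi_pos.
    - intros r Hr. now apply HS.
    - intros r Hr. destruct (Hb1' r Hr) as (_ & _ & A).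
      destruct (Hb2' r Hr) as (_ & _ & A').
      pose proof (phi_le1 c r H Hr).
      assert (B * phi c r <= B * 1) by (apply Rmult_le_compat_l; lra).
      eapply Rle_trans; [apply Rabs_triang|]. rewrite Rabs_Ropp. lra. }
  assert (BQ : forall r, 1 <= r -> Rabs (q1' r - q2' r) <= rate c * d * phi c r).
  { intros r Hr. eapply Rle_trans; [now apply BQ0|].
    apply Rmult_le_compat_r; [left; now apply phi_pos|].
    rewrite Er. now apply Rmult_le_compat_l. }
  assert (BP : forall r, 1 <= r -> Rabs (p1' r - p2' r) <= rate c * d * phi c r).
  { rewrite Er.
    apply (forward_comparison (lam c) (slack c) (b * d) (fun r => p1' r - p2' r) _
      (fun r => S1 r - S2 r) (phi c) _ Hbd ltac:(lra) HP) with (2 := hderiv_phi c H).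
    - intros r _. ring.
    - intros r Hr. apply (phi_slow c r H). lra.
    - intros r Hr. now apply HS.
    - rewrite <- Er, I1, I2.
      replace (q1' 1 - 2 * lam c * rb - (q2' 1 - 2 * lam c * rb))
        with (q1' 1 - q2' 1) by ring. apply BQ. lra. }
  intros r Hr. split; [|split; [now apply BP|now apply BQ]].
  revert r Hr.
  apply (tail_comparison _ _ (fun r => rate c * d / lam c * Phi c r) _ HX
    (hderiv_scal (rate c * d / lam c) _ _ (hderiv_Phi c H))).
  - intros r Hr.
    replace ((q1' r - p1' r) / (2 * lam c) - (q2' r - p2' r) / (2 * lam c))
      with (((q1' r - q2' r) - (p1' r - p2' r)) / (2 * lam c)) by (field; lra).
    replace (- (rate c * d / lam c * - phi c r)) with (rate c * d * phi c r / lam c)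
      by (field; lra).
    apply half_diff_bound; [easy|apply BP; lra|apply BQ; lra].
  - replace (Finite 0) with (Finite (rho_inf c - rho_inf c)) by (f_equal; ring).
    apply is_lim_minus'; apply (is_lim_of_Phi_bound c (B / lam c)); try easy;
      intros r Hr; [apply Hb1'|apply Hb2']; easy.
  - replace (Finite 0) with (Rbar_mult (rate c * d / lam c) 0)
      by (simpl; f_equal; ring).
    apply is_lim_scal_l. now apply is_lim_Phi.
Qed.

Lemma in_ball_rest c B : admissible c -> 0 <= B ->
  in_ball c B (fun _ => rho_inf c) (fun _ => 0) (fun _ => 0).
Proof.
  intros H HB. pose proof (lam_ge1 c H). split.
  - repeat split; apply hcont_const.
  - intros r Hr. pose proof (phi_pos c r H Hr). pose proof (Phi_pos c r H Hr).
    assert (0 <= B / lam c) by (apply Rdiv_le_0_compat; lra).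
    rewrite Rminus_diag, Rabs_R0.
    repeat split; apply Rmult_le_pos; lra.
Qed.

Definition data_size (rb u : R) : R := Rabs rb + Rabs u ^ 2.

Lemma data_size_pos rb u : 0 <= data_size rb u.
Proof.
  apply Rplus_le_le_0_compat; [apply Rabs_pos|apply pow_le, Rabs_pos].
Qed.

(** The source is compared with that of the rest state, from which it differs by at most
    [(lam - 3 * slack) * B * phi]. Staying in the ball allows [(lam - slack) * B * phi], so
    [2 * slack * B] remains for the forcing and the boundary datum; this fixes the constant in front
    of [data_size]. *)
Lemma step_exists c : admissible c -> exists K C, 0 <= K /\ 0 < C /\
  forall u rb B x p q,
  Rabs u <= 1 -> 0 <= B <= 1 -> B <= rho_inf c / 2 ->
  K * (B + Rabs u) <= slack c -> C * data_size rb u <= B ->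
  in_ball c B x p q ->
  exists x' p' q', in_ball c B x' p' q' /\ step c u rb x p q x' p' q'.
Proof.
  intros H. destruct (source_along_close c H) as [K [HK HS]].
  destruct (source_rest_bound c H) as [K0 [HK0 HR0]].
  pose proof (lam_ge1 c H) as Hl. pose proof (slack_pos c H) as Hsp.
  pose proof (slack_lt c H) as Hsl.
  pose proof (phi_pos c 1 H (Rle_refl 1)) as Hf1.
  (* Chosen so that the boundary term [2 * lam * Rabs rb] equals [k1 * Rabs rb / lam * phi c 1] and
     can be counted as part of the source bound. *)
  set (k1 := 2 * lam c ^ 2 / phi c 1).
  assert (Hk1 : 0 < k1).
  { apply Rdiv_lt_0_compat; [|easy]. assert (0 < lam c ^ 2) by (apply pow_lt; lra). lra. }
  exists K, ((K0 + k1) / (2 * slack c)).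
  split; [easy|]. split; [apply Rdiv_lt_0_compat; lra|].
  intros u rb B x p q Hu HB HBr Hs HC Hb.
  set (a := lam c - 3 * slack c).
  assert (Hwr : state_close c B x p q (fun _ => rho_inf c) (fun _ => 0) (fun _ => 0)).
  { destruct Hb as [_ Hb]. intros r Hr. rewrite !Rminus_0_r. now apply Hb. }
  specialize (HS u B B x p q _ _ _ Hu HB HBr ltac:(lra) Hs Hb
    (in_ball_rest c B H ltac:(lra)) Hwr). fold a in HS.
  set (K1 := a * B + K0 * Rabs u ^ 2).
  assert (HK1 : 0 <= K1).
  { apply Rplus_le_le_0_compat; apply Rmult_le_pos; try lra; [unfold a; lra|].
    apply pow_le, Rabs_pos. }
  set (S := source_along c u x p q) in *.
  assert (BS : forall r, 1 <= r -> Rabs (S r) <= K1 * phi c r).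
  { intros r Hr. specialize (HS r Hr). specialize (HR0 u r Hr).
    unfold source_along in HS at 1.
    replace ((0 - 0) / (2 * lam c)) with 0 in HS by (field; lra).
    replace ((0 + 0) / 2) with 0 in HS by field.
    set (s0 := source c (rho_inf c * u) r (rho_inf c) 0 0) in *.
    replace (S r) with ((S r - s0) + s0) by ring.
    eapply Rle_trans; [apply Rabs_triang|]. unfold K1. lra. }
  assert (CS : hcont S) by (apply (hcont_source_along c u B); easy || lra).
  assert (BS1 : forall r, 1 <= r -> Rabs (S r) <= K1).
  { intros r Hr. eapply Rle_trans; [now apply BS|].
    rewrite <- (Rmult_1_r K1) at 2. apply Rmult_le_compat_l; [easy|now apply phi_le1]. }
  assert (Hrb : 0 <= Rabs rb) by apply Rabs_pos.
  assert (Hu2 : 0 <= Rabs u ^ 2) by (apply pow_le, Rabs_pos).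
  set (K2 := K1 + k1 * Rabs rb).
  assert (HK2 : 0 <= k1 * Rabs rb) by (apply Rmult_le_pos; lra).
  assert (EB : K2 / (lam c - slack c) <= B).
  { apply Rle_div_l; [lra|]. unfold K2, K1, a.
    assert (A : (K0 + k1) * data_size rb u <= B * (2 * slack c)).
    { apply (Rmult_le_compat_r (2 * slack c)) in HC; [|lra].
      replace ((K0 + k1) / (2 * slack c) * data_size rb u * (2 * slack c))
        with ((K0 + k1) * data_size rb u) in HC by (field; lra). easy. }
    unfold data_size in A.
    assert (0 <= K0 * Rabs rb) by (apply Rmult_le_pos; lra).
    assert (0 <= k1 * Rabs u ^ 2) by (apply Rmult_le_pos; lra).
    lra. }
  assert (Hi : / lam c <= / (lam c - slack c)) by (apply Rinv_le_contravar; lra).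
  assert (Hi0 : 0 < / (lam c - slack c)) by (apply Rinv_0_lt_compat; lra).
  assert (Hi1 : 0 < / lam c) by (apply Rinv_0_lt_compat; lra).
  destruct (bounded_solution (lam c) K1 S ltac:(lra) CS BS1) as [Q [HQ BQ]].
  assert (BQ' : forall r, 1 <= r -> Rabs (Q r) <= K1 / lam c * phi c r).
  { apply (bounded_comparison (lam c) K1 (K1 / lam c) Q _ S (phi c) _ ltac:(lra)
      HK1 HQ) with (2 := hderiv_phi c H); try easy.
    - intros r Hr. apply (phi_slow c r H). lra.
    - intros r Hr. left; now apply phi_pos. }
  destruct (forward_solution (lam c) (Q 1 - 2 * lam c * rb) S CS) as [P [HP P1]].
  assert (BP : forall r, 1 <= r -> Rabs (P r) <= B * phi c r).
  { intros r Hr. eapply Rle_trans.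
    - revert r Hr.
      apply (forward_comparison (lam c) (slack c) K2 P _ S (phi c) _ ltac:(unfold K2; lra)
        ltac:(lra) HP) with (2 := hderiv_phi c H); try easy.
      + intros r Hr. apply (phi_slow c r H). lra.
      + intros r Hr. eapply Rle_trans; [now apply BS|].
        apply Rmult_le_compat_r; [left; now apply phi_pos|unfold K2; lra].
      + rewrite P1. eapply Rle_trans; [apply Rabs_triang|].
        rewrite Rabs_Ropp, !Rabs_mult, (Rabs_pos_eq 2), (Rabs_pos_eq (lam c)) by lra.
        specialize (BQ' 1 (Rle_refl 1)).
        assert (E : 2 * lam c * Rabs rb = k1 * Rabs rb / lam c * phi c 1)
          by (unfold k1; field; lra).
        assert (A : K2 / lam c * phi c 1 <= K2 / (lam c - slack c) * phi c 1).
        { apply Rmult_le_compat_r; [lra|].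
          apply Rmult_le_compat_l; [unfold K2; lra|easy]. }
        replace (K2 / lam c * phi c 1)
          with (K1 / lam c * phi c 1 + k1 * Rabs rb / lam c * phi c 1) in A
          by (unfold K2; field; lra).
        lra.
    - apply Rmult_le_compat_r; [left; now apply phi_pos|easy]. }
  assert (BQB : forall r, 1 <= r -> Rabs (Q r) <= B * phi c r).
  { intros r Hr. eapply Rle_trans; [now apply BQ'|].
    apply Rmult_le_compat_r; [left; now apply phi_pos|].
    apply Rle_trans with (K2 / (lam c - slack c)); [|easy].
    apply Rmult_le_compat; unfold K2; lra. }
  assert (HBl : 0 <= B / lam c) by (apply Rdiv_le_0_compat; lra).
  destruct (hderiv_tail (fun r => (Q r - P r) / (2 * lam c))
    (fun r => B / lam c * Phi c r) (fun r => B / lam c * - phi c r)) as [J [HJ BJ]].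
  - apply (hcont_mult _ (fun _ => / (2 * lam c)));
      [apply hcont_minus; [apply HQ|apply HP]|apply hcont_const].
  - apply hderiv_scal. now apply hderiv_Phi.
  - intros r Hr. apply Rmult_le_pos; [easy|left; now apply Phi_pos].
  - intros r Hr.
    replace (- (B / lam c * - phi c r)) with (B * phi c r / lam c) by (field; lra).
    apply half_diff_bound; [easy|apply BP; lra|apply BQB; lra].
  - exists (fun r => rho_inf c + J r), P, Q.
    assert (HX : hderiv (fun r => rho_inf c + J r)
                        (fun r => (Q r - P r) / (2 * lam c))).
    { eapply hderiv_ext; [| |apply (hderiv_plus _ _ _ _ (hderiv_const (rho_inf c)) HJ)].
      - reflexivity.
      - intros; simpl; ring. }
    split; [split|].
    + repeat split; [apply HX|apply HP|apply HQ].
    + intros r Hr. replace (rho_inf c + J r - rho_inf c) with (J r) by ring.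
      split; [now apply BJ|]. split; [now apply BP|now apply BQB].
    + now repeat split; try apply HP; try apply HQ; try apply HX.
Qed.

(** * Completeness of the ball and the fixed point *)

Lemma hcont_uniform_limit (f : nat -> R -> R) (g : R -> R) :
  (forall k, hcont (f k)) ->
  (forall e, 0 < e -> exists k, forall r, 1 <= r -> Rabs (f k r - g r) <= e) ->
  hcont g.
Proof.
  intros Hf Hu r eps Heps.
  destruct (Hu (eps / 4) ltac:(lra)) as [k Hk].
  destruct (Hf k r (eps / 4) ltac:(lra)) as [d [Hd H]].
  exists d. split; [easy|]. intros s Hs. specialize (H s Hs).
  simpl in *. unfold Rdist in *.
  pose proof (Hk (Rmax 1 s) (Rmax_l _ _)) as A.
  pose proof (Hk (Rmax 1 r) (Rmax_l _ _)) as B.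
  apply Rabs_def2 in H. apply Rabs_le_between in A. apply Rabs_le_between in B.
  apply Rabs_def1; lra.
Qed.

Lemma geometric_small (theta c e : R) :
  0 <= theta < 1 -> 0 <= c -> 0 < e -> exists k, c * theta ^ k <= e.
Proof.
  intros Ht Hc He.
  destruct (pow_lt_1_zero theta) with (y := e / (c + 1)) as [k Hk].
  - rewrite Rabs_pos_eq; lra.
  - apply Rdiv_lt_0_compat; lra.
  - exists k. specialize (Hk k (Nat.le_refl k)).
    rewrite Rabs_pos_eq in Hk by (apply pow_le; lra).
    assert (0 <= theta ^ k) by (apply pow_le; lra).
    apply (Rmult_lt_compat_r (c + 1)) in Hk; [|lra].
    replace (e / (c + 1) * (c + 1)) with e in Hk by (field; lra). lra.
Qed.

Lemma le_of_geometric (theta a b c : R) :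
  0 <= theta < 1 -> 0 <= c -> (forall k, a <= b + c * theta ^ k) -> a <= b.
Proof.
  intros Ht Hc H. apply le_epsilon. intros e He.
  destruct (geometric_small theta c e Ht Hc He) as [k Hk].
  specialize (H k). lra.
Qed.

(** The three functions of a state are stored as one real function on [slot * R], the form required
    by [contraction_fixed_point]. *)
Inductive slot := Density | Backward | Forward.

Definition weight (c : coeffs) (ir : slot * R) : R :=
  match fst ir with
  | Density => / lam c * Phi c (Rmax 1 (snd ir))
  | _ => phi c (Rmax 1 (snd ir))
  end.

Definition component (s : slot * R -> R) (i : slot) (r : R) : R := s (i, r).

(** The abstract contraction measures distance at every real point, whereas [state_close] says
    nothing left of 1; freezing the values there makes the two agree. *)
Definition clamped (s : slot * R -> R) : Prop :=
  forall i r, s (i, r) = s (i, Rmax 1 r).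

Definition assemble (x p q : R -> R) (ir : slot * R) : R :=
  match fst ir with
  | Density => x (Rmax 1 (snd ir))
  | Forward => p (Rmax 1 (snd ir))
  | Backward => q (Rmax 1 (snd ir))
  end.

Lemma close_of_weight c d s1 s2 :
  (forall ir, Rabs (s1 ir - s2 ir) <= d * weight c ir) ->
  state_close c d (component s1 Density) (component s1 Forward) (component s1 Backward)
             (component s2 Density) (component s2 Forward) (component s2 Backward).
Proof.
  intros H r Hr. unfold component.
  pose proof (H (Density, r)) as A. pose proof (H (Forward, r)) as B.
  pose proof (H (Backward, r)) as C. unfold weight in *. simpl in *.
  rewrite Rmax_right in * by easy. repeat split; try easy.
  unfold Rdiv. now rewrite Rmult_assoc.
Qed.

Lemma weight_of_close c d s1 s2 : clamped s1 -> clamped s2 ->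
  state_close c d (component s1 Density) (component s1 Forward) (component s1 Backward)
             (component s2 Density) (component s2 Forward) (component s2 Backward) ->
  forall ir, Rabs (s1 ir - s2 ir) <= d * weight c ir.
Proof.
  intros H1 H2 H [i r]. rewrite H1, H2.
  destruct (H (Rmax 1 r) (Rmax_l _ _)) as (A & B & C). unfold component in *.
  unfold weight; simpl. destruct i; try easy.
  now rewrite <- Rmult_assoc.
Qed.

Lemma weight_bounds c ir : admissible c -> 0 <= weight c ir <= 1.
Proof.
  intros H. destruct ir as [i r]. unfold weight; simpl.
  pose proof (phi_pos c (Rmax 1 r) H (Rmax_l _ _)).
  pose proof (phi_le1 c (Rmax 1 r) H (Rmax_l _ _)).
  pose proof (Phi_pos c (Rmax 1 r) H (Rmax_l _ _)).
  pose proof (Phi_scaled_le c 1 (Rmax 1 r) H ltac:(lra) (Rmax_l _ _)) as A.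
  unfold Rdiv in A. rewrite Rmult_1_l in A.
  pose proof (lam_ge1 c H).
  destruct i; try lra. split; [|easy].
  apply Rmult_le_pos; [left; apply Rinv_0_lt_compat; lra|lra].
Qed.

Lemma in_ball_ext c B x p q x' p' q' :
  (forall r, 1 <= r -> x r = x' r) -> (forall r, 1 <= r -> p r = p' r) ->
  (forall r, 1 <= r -> q r = q' r) -> in_ball c B x p q -> in_ball c B x' p' q'.
Proof.
  intros Ex Ep Eq [(A1 & A2 & A3) B1]. split.
  - repeat split; eapply hcont_ext; eassumption || easy.
  - intros r Hr. rewrite <- Ex, <- Ep, <- Eq by easy. now apply B1.
Qed.

Lemma step_ext c u rb x p q x1 p1 q1 x2 p2 q2 :
  (forall r, 1 <= r -> x1 r = x2 r) -> (forall r, 1 <= r -> p1 r = p2 r) ->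
  (forall r, 1 <= r -> q1 r = q2 r) ->
  step c u rb x p q x1 p1 q1 -> step c u rb x p q x2 p2 q2.
Proof.
  intros Ex Ep Eq (A & B & C & D). refine (conj _ (conj _ (conj _ _))).
  - eapply hderiv_ext; [exact Ep| |exact A]. intros r Hr; simpl.
    now rewrite Ep by lra.
  - eapply hderiv_ext; [exact Eq| |exact B]. intros r Hr; simpl.
    now rewrite Eq by lra.
  - eapply hderiv_ext; [exact Ex| |exact C]. intros r Hr; simpl.
    now rewrite Ep, Eq by lra.
  - now rewrite <- Ep, <- Eq by lra.
Qed.

Lemma step_fixed_point c : admissible c -> exists K C, 0 <= K /\ 0 < C /\
  forall u rb B,
  Rabs u <= 1 -> 0 <= B <= 1 -> B <= rho_inf c / 2 ->
  K * (B + Rabs u) <= slack c -> C * data_size rb u <= B ->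
  exists x p q, in_ball c B x p q /\ step c u rb x p q x p q.
Proof.
  intros H. destruct (step_contracts c H) as [K1 [HK1 Hcontr]].
  destruct (step_exists c H) as [K2 [C [HK2 [HC Hex]]]].
  exists (K1 + K2), C. split; [lra|]. split; [easy|].
  intros u rb B Hu HB HBr Hs HCB.
  pose proof (rate_bounds c H) as Hrate.
  assert (HBu : 0 <= B + Rabs u) by (pose proof (Rabs_pos u); lra).
  assert (Hs1 : K1 * (B + Rabs u) <= slack c).
  { assert (0 <= K2 * (B + Rabs u)) by now apply Rmult_le_pos. lra. }
  assert (Hs2 : K2 * (B + Rabs u) <= slack c).
  { assert (0 <= K1 * (B + Rabs u)) by now apply Rmult_le_pos. lra. }
  destruct (contraction_fixed_point (slot * R) (weight c)
    (fun s => clamped s /\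
       in_ball c B (component s Density) (component s Forward) (component s Backward))
    (fun s s' => step c u rb
       (component s Density) (component s Forward) (component s Backward)
       (component s' Density) (component s' Forward) (component s' Backward))
    (rate c) (2 * B)) as (s & s' & [Cs Ks] & [Cs' Ks'] & Hss & E).
  - easy.
  - lra.
  - intros ir. now apply weight_bounds.
  - exists (assemble (fun _ => rho_inf c) (fun _ => 0) (fun _ => 0)). split.
    + intros [|  |] r; reflexivity.
    + apply (in_ball_rest c B H ltac:(lra)).
  - intros s [Cs Ks].
    destruct (Hex u rb B _ _ _ Hu HB HBr Hs2 HCB Ks) as (x & p & q & Kx & Sx).
    assert (Ex : forall f r, 1 <= r -> f r = f (Rmax 1 r) :> R)
      by (intros f r Hr; now rewrite Rmax_right).
    exists (assemble x p q). split; [split|].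
    + intros [|  |] r; unfold assemble; simpl;
        now rewrite (Rmax_right 1 (Rmax 1 r)) by apply Rmax_l.
    + apply (in_ball_ext c B x p q); auto.
    + apply (step_ext c u rb _ _ _ x p q); auto.
  - intros s1 s2 [C1 [_ K3]] [C2 [_ K4]]. apply weight_of_close; [easy|easy|].
    intros r Hr. destruct (K3 r Hr) as (A1 & A2 & A3).
    destruct (K4 r Hr) as (B1 & B2 & B3). repeat apply conj.
    + replace (component s1 Density r - component s2 Density r)
        with ((component s1 Density r - rho_inf c)
              - (component s2 Density r - rho_inf c)) by ring.
      eapply Rle_trans; [apply Rabs_triang|]. rewrite Rabs_Ropp. lra.
    + eapply Rle_trans; [apply Rabs_triang|]. rewrite Rabs_Ropp. lra.
    + eapply Rle_trans; [apply Rabs_triang|]. rewrite Rabs_Ropp. lra.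
  - intros s1 s2 s1' s2' d Hd [C1 L1] [C2 L2] [C1' L1'] [C2' L2'] S1 S2 Hw.
    apply weight_of_close; [easy|easy|].
    apply (Hcontr u rb B d _ _ _ _ _ _ _ _ _ _ _ _ Hu HB HBr Hd Hs1 L1 L2 L1' L2' S1 S2).
    now apply close_of_weight.
  (* Closedness of the ball: the weights are at most 1, so convergence is uniform and preserves
     continuity, and the pointwise bounds pass to the limit. *)
  - intros sk s b Hb Hk Hlim.
    assert (Hlim1 : forall k ir, Rabs (sk k ir - s ir) <= b * rate c ^ k).
    { intros k ir. eapply Rle_trans; [apply Hlim|].
      rewrite <- (Rmult_1_r (b * rate c ^ k)) at 2.
      apply Rmult_le_compat_l; [|now apply weight_bounds].
      apply Rmult_le_pos; [easy|apply pow_le; lra]. }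
    assert (Hc : forall i, (forall k, hcont (component (sk k) i)) ->
                 hcont (component s i)).
    { intros i Hi. apply (hcont_uniform_limit (fun k => component (sk k) i)); [easy|].
      intros e He. destruct (geometric_small (rate c) b e Hrate Hb He) as [k Hk1].
      exists k. intros r _. eapply Rle_trans; [apply Hlim1|easy]. }
    assert (Hle : forall ir z a, (forall k, Rabs (sk k ir - z) <= a) ->
                  Rabs (s ir - z) <= a).
    { intros ir z a Ha. apply (le_of_geometric (rate c) _ _ b Hrate Hb). intros k.
      replace (s ir - z) with ((sk k ir - z) - (sk k ir - s ir)) by ring.
      eapply Rle_trans; [apply Rabs_triang|]. rewrite Rabs_Ropp.
      specialize (Ha k). specialize (Hlim1 k ir). lra. }
    split; [|split].
    + intros i r. apply Rminus_diag_uniq.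
      apply (geometric_bound_zero (rate c) _ (2 * b) Hrate). intros k.
      destruct (Hk k) as [Ck _].
      replace (s (i, r) - s (i, Rmax 1 r))
        with ((sk k (i, Rmax 1 r) - s (i, Rmax 1 r)) - (sk k (i, r) - s (i, r)))
        by (rewrite (Ck i r); ring).
      eapply Rle_trans; [apply Rabs_triang|]. rewrite Rabs_Ropp.
      pose proof (Hlim1 k (i, r)). pose proof (Hlim1 k (i, Rmax 1 r)). lra.
    + repeat apply conj; apply Hc; intros k; apply (Hk k).
    + intros r Hr. rewrite <- (Rminus_0_r (component s Forward r)),
        <- (Rminus_0_r (component s Backward r)).
      repeat apply conj; apply Hle; intros k; rewrite ?Rminus_0_r; now apply (Hk k).
  - exists (component s Density), (component s Forward), (component s Backward).
    split; [easy|].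
    apply (step_ext c u rb _ _ _ (component s' Density) (component s' Forward)
      (component s' Backward)); [| | |easy]; intros r _; apply E.
Qed.

(** A fixed point is its own image, so [step_contracts] can be iterated on the same pair, starting
    from the distance [2 * B]. *)
Lemma step_fixed_point_unique c : admissible c -> exists K, 0 <= K /\
  forall u rb B x1 p1 q1 x2 p2 q2,
  Rabs u <= 1 -> 0 <= B <= 1 -> B <= rho_inf c / 2 ->
  K * (B + Rabs u) <= slack c ->
  in_ball c B x1 p1 q1 -> in_ball c B x2 p2 q2 ->
  step c u rb x1 p1 q1 x1 p1 q1 -> step c u rb x2 p2 q2 x2 p2 q2 ->
  forall r, 1 <= r -> x1 r = x2 r.
Proof.
  intros H. destruct (step_contracts c H) as [K [HK Hcontr]].
  exists K. split; [easy|].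
  intros u rb B x1 p1 q1 x2 p2 q2 Hu HB HBr Hs B1 B2 S1 S2.
  pose proof (rate_bounds c H) as Hrate.
  assert (G : forall k, state_close c (2 * B * rate c ^ k) x1 p1 q1 x2 p2 q2).
  { induction k as [|k IH].
    - rewrite pow_O, Rmult_1_r. destruct B1 as [_ K1], B2 as [_ K2].
      intros r Hr. destruct (K1 r Hr) as (A1 & A2 & A3).
      destruct (K2 r Hr) as (A4 & A5 & A6). repeat apply conj.
      + replace (x1 r - x2 r) with ((x1 r - rho_inf c) - (x2 r - rho_inf c)) by ring.
        eapply Rle_trans; [apply Rabs_triang|]. rewrite Rabs_Ropp. lra.
      + eapply Rle_trans; [apply Rabs_triang|]. rewrite Rabs_Ropp. lra.
      + eapply Rle_trans; [apply Rabs_triang|]. rewrite Rabs_Ropp. lra.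
    - replace (2 * B * rate c ^ S k) with (rate c * (2 * B * rate c ^ k)) by (simpl; ring).
      apply (Hcontr u rb B _ x1 p1 q1 x2 p2 q2); try easy.
      apply Rmult_le_pos; [lra|apply pow_le; lra]. }
  intros r Hr. apply Rminus_diag_uniq.
  apply (geometric_bound_zero (rate c) _ (2 * B) Hrate). intros k.
  destruct (G k r Hr) as [A _]. eapply Rle_trans; [exact A|].
  apply Phi_scaled_le; try easy.
  apply Rmult_le_pos; [lra|apply pow_le; lra].
Qed.

(** * Profiles and the differential equations *)

Definition profile (c : coeffs) (m : R) (x w v : R -> R) : Prop :=
  hderiv x w /\ hderiv w v /\
  hderiv v (fun r => lam c ^ 2 * w r + source c m r (x r) (w r) (v r)).

Lemma profile_of_step c u rb x p q : admissible c ->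
  step c u rb x p q x p q ->
  profile c (x 1 * u) x (fun r => (q r - p r) / (2 * lam c))
    (fun r => (q r + p r) / 2) /\ (q 1 - p 1) / (2 * lam c) = rb.
Proof.
  intros H (P & Q & X & I). pose proof (lam_ge1 c H) as Hl.
  split; [split; [easy|split]|].
  - eapply hderiv_ext; [| |apply (hderiv_scal (/ (2 * lam c)) _ _
      (hderiv_minus _ _ _ _ Q P))]; intros; simpl; field; lra.
  - eapply hderiv_ext; [| |apply (hderiv_scal (/ 2) _ _
      (hderiv_plus _ _ _ _ Q P))]; intros; simpl.
    + field.
    + unfold source_along. field. lra.
  - rewrite I. field. lra.
Qed.

Lemma step_of_profile c u rb x w v : admissible c ->
  profile c (x 1 * u) x w v -> w 1 = rb ->
  step c u rb x (fun r => v r - lam c * w r) (fun r => v r + lam c * w r)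
            x (fun r => v r - lam c * w r) (fun r => v r + lam c * w r).
Proof.
  intros H (X & W & V) I. pose proof (lam_ge1 c H) as Hl.
  assert (E : forall r, source_along c u x (fun r => v r - lam c * w r)
     (fun r => v r + lam c * w r) r = source c (x 1 * u) r (x r) (w r) (v r)).
  { intros r. unfold source_along. f_equal; field; lra. }
  refine (conj _ (conj _ (conj _ _))).
  - eapply hderiv_ext; [| |apply (hderiv_minus _ _ _ _ V (hderiv_scal (lam c) _ _ W))];
      intros; simpl; [ring|]. rewrite E. ring.
  - eapply hderiv_ext; [| |apply (hderiv_plus _ _ _ _ V (hderiv_scal (lam c) _ _ W))];
      intros; simpl; [ring|]. rewrite E. ring.
  - eapply hderiv_ext; [| |exact X]; intros; simpl; [easy|field; lra].
  - rewrite I. ring.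
Qed.

Lemma hderiv_inv_id : hderiv (fun r => / r) (fun r => - / r * / r).
Proof. apply hderiv_of_derive. intros r Hr. auto_derive; [lra|field; lra]. Qed.

Lemma hderiv_inv_pow j :
  hderiv (fun r => / r ^ j) (fun r => - INR j * / r ^ j * / r).
Proof.
  induction j as [|j IH].
  - eapply hderiv_ext; [| |apply (hderiv_const 1)]; intros; simpl; field; lra.
  - eapply hderiv_ext; [| |apply (hderiv_mult _ _ _ _ hderiv_inv_id IH)];
      intros r Hr; cbv beta; rewrite ?S_INR; simpl pow;
      assert (r ^ j <> 0) by (apply pow_nonzero; lra); field; lra.
Qed.

Lemma Derive_hderiv (f g dg : R -> R) (r : R) :
  (forall s, 1 < s -> f s = g s) -> hderiv g dg -> 1 < r -> Derive f r = dg r.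
Proof.
  intros E [_ Hg] Hr. apply is_derive_unique.
  apply (is_derive_ext_loc g); [|auto].
  apply (locally_gt 1); [easy|]. intros s Hs. symmetry. auto.
Qed.

Definition velocity (c : coeffs) (m : R) (x : R -> R) (r : R) : R :=
  m * / x r * / r ^ codim c.

Lemma hderiv_velocity c m x w : hderiv x w -> (forall r, 1 <= r -> 0 < x r) ->
  hderiv (velocity c m x)
    (fun r => - m * (w r * / x r ^ 2 + NN c * / x r * / r) * / r ^ codim c).
Proof.
  intros X Hp.
  assert (H0 : forall r, 1 <= r -> x r <> 0)
    by (intros r Hr; specialize (Hp r Hr); lra).
  eapply hderiv_ext; [| |apply (hderiv_mult _ _ _ _
    (hderiv_scal m _ _ (hderiv_inv _ _ X H0)) (hderiv_inv_pow (codim c)))].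
  - reflexivity.
  - intros r Hr; simpl. unfold NN. field. repeat split; try lra.
    + apply pow_nonzero; lra.
    + apply H0; lra.
Qed.

Lemma continuity_eq_velocity c m x u r :
  (forall r, 1 <= r -> 0 < x r) ->
  (forall r, 1 <= r -> u r = velocity c m x r) -> 1 < r ->
  continuity_eq (S (codim c)) x u r.
Proof.
  intros Hp Eu Hr. unfold continuity_eq.
  replace (S (codim c) - 1)%nat with (codim c) by lia.
  rewrite (Derive_hderiv _ (fun _ => m) (fun _ => 0)); [ring| |apply hderiv_const|easy].
  intros s Hs. rewrite Eu by lra. unfold velocity. field. split.
  - apply pow_nonzero; lra.
  - specialize (Hp s). lra.
Qed.

(** [r ^ codim * x * u] is constant. The equation holds only for [r > 1], but continuity at the
    endpoint lets the constant be read off at 1. *)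
Lemma velocity_of_continuity_eq c x w u du :
  hderiv x w -> hderiv u du -> (forall r, 1 <= r -> 0 < x r) ->
  (forall r, 1 < r -> continuity_eq (S (codim c)) x u r) ->
  forall r, 1 <= r -> u r = velocity c (x 1 * u 1) x r.
Proof.
  intros X U Hp Hc r Hr.
  assert (P : hderiv (fun s => s ^ codim c) (fun s => INR (codim c) * s ^ pred (codim c))).
  { apply hderiv_of_derive. intros s Hs. auto_derive; [easy|ring]. }
  pose proof (hderiv_mult _ _ _ _ (hderiv_mult _ _ _ _ P X) U) as F.
  assert (A : forall s, 0 < s -> s ^ codim c <> 0) by (intros; apply pow_nonzero; lra).
  pose proof (hderiv_const_eq _ _ r F) as E. simpl in E.
  rewrite pow1, Rmult_1_l in E. unfold velocity. rewrite <- E; [|..|easy].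
  - field. split; [apply A; lra|specialize (Hp r Hr); lra].
  - intros s Hs. specialize (Hc s Hs). unfold continuity_eq in Hc.
    replace (S (codim c) - 1)%nat with (codim c) in Hc by lia.
    rewrite (Derive_hderiv _ _ _ s (fun _ _ => eq_refl) F Hs) in Hc.
    apply Rmult_integral in Hc. destruct Hc as [Hc|Hc]; [|exact Hc].
    destruct (Rinv_neq_0_compat _ (A s ltac:(lra)) Hc).
Qed.

Lemma momentum_eq_iff c m x w v z u r : admissible c ->
  hderiv x w -> hderiv w v -> hderiv v z -> (forall r, 1 <= r -> 0 < x r) ->
  (forall r, 1 <= r -> u r = velocity c m x r) -> 1 < r ->
  momentum_eq (S (codim c)) (gam c) (visc c) (capil c) x u r <->
  z r = lam c ^ 2 * w r + source c m r (x r) (w r) (v r).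
Proof.
  intros H X W V Hp Eu Hr. unfold momentum_eq.
  replace (S (codim c) - 1)%nat with (codim c) by lia.
  assert (HN : INR (S (codim c)) - 1 = NN c) by (rewrite S_INR; unfold NN; ring).
  rewrite HN.
  assert (H0 : forall r, 1 <= r -> x r <> 0)
    by (intros s Hs; specialize (Hp s Hs); lra).
  assert (A : forall s, 1 < s -> s ^ codim c <> 0) by (intros; apply pow_nonzero; lra).
  rewrite (Derive_hderiv u _ _ r (fun s Hs => Eu s (Rlt_le _ _ Hs))
    (hderiv_velocity c m x w X Hp) Hr).
  rewrite (Derive_hderiv (fun s => pressure (gam c) (x s)) _ _ r (fun s Hs => eq_refl)
    (hderiv_Rpower x w (gam c) X Hp) Hr).
  pose proof (hderiv_inv _ _ X H0) as I.
  (* Since [r ^ codim * u = m / x], the divergence of the velocity contains no curvature term. *)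
  assert (D1 : forall s, 1 < s -> Derive (fun t => t ^ codim c * u t) s / s ^ codim c
     = - m * (w s * (/ x s * / x s) * / s ^ codim c)).
  { intros s Hs.
    rewrite (Derive_hderiv _ _ _ s) with (2 := hderiv_scal m _ _ I); [|..|easy].
    - field. split; first [apply A; lra|apply H0; lra].
    - intros t Ht. rewrite Eu by lra. unfold velocity. field.
      split; first [apply A; lra|apply H0; lra]. }
  rewrite (Derive_hderiv _ _ _ r D1 (hderiv_scal (- m) _ _ (hderiv_mult _ _ _ _
    (hderiv_mult _ _ _ _ W (hderiv_mult _ _ _ _ I I)) (hderiv_inv_pow (codim c)))) Hr).
  assert (D2 : forall s, 1 < s -> Derive_n x 2 s + NN c / s * Derive x s
     = v s + NN c * (/ s * w s)).
  { intros s Hs. change (Derive_n x 2 s) with (Derive (Derive x) s).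
    assert (Dx : forall t, 1 < t -> Derive x t = w t).
    { intros t Ht. now apply (Derive_hderiv x x w). }
    rewrite (Derive_hderiv (Derive x) w v s Dx W Hs), Dx by easy. field. lra. }
  rewrite (Derive_hderiv _ _ _ r D2 (hderiv_plus _ _ _ _ V (hderiv_scal (NN c) _ _
    (hderiv_mult _ _ _ _ hderiv_inv_id W))) Hr).
  cbv beta. rewrite (Eu r) by lra. fold (NN c).
  assert (Hc : 0 < capil c) by apply H. specialize (Hp r ltac:(lra)).
  assert (EP : gam c * Rpower (x r) (gam c) * / x r = x r * enth' c (x r)).
  { unfold enth'. replace (gam c) with (gam c - 2 + 1 + 1) at 2 by ring.
    rewrite !Rpower_plus, Rpower_1 by easy. field. lra. }
  rewrite EP. unfold velocity, source, nonlin, alpha.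
  set (h := enth' c (x r)). set (h0 := enth' c (rho_inf c)).
  set (xr := x r) in *. set (wr := w r). set (vr := v r). set (zr := z r).
  pose proof (A r Hr) as Ha. set (a := r ^ codim c) in *.
  (* One identity gives both directions: the residual of the momentum equation is [capil * x] times
     that of the third-order equation. *)
  match goal with |- ?l = ?rr <-> _ = ?s =>
    assert (E : l - rr = capil c * xr * (s - zr)) by (field; repeat split; lra) end.
  assert (Hkx : capil c * xr <> 0) by (apply Rmult_integral_contrapositive; lra).
  split; intros Hz.
  - rewrite Hz in E. rewrite Rminus_diag in E. symmetry in E.
    apply Rmult_integral in E. destruct E as [E|E]; [easy|lra].
  - rewrite <- Hz in E. rewrite Rminus_diag, Rmult_0_r in E. lra.
Qed.

(** * Smoothness of profiles *)

(* Closed under differentiation when [x], [w], [v] is a profile, which gives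
   derivatives of all orders. *)
Inductive profile_algebra (c : coeffs) (x w v : R -> R) : (R -> R) -> Prop :=
| alg_const a : profile_algebra c x w v (fun _ => a)
| alg_inv_id : profile_algebra c x w v (fun r => / r)
| alg_density : profile_algebra c x w v x
| alg_first : profile_algebra c x w v w
| alg_second : profile_algebra c x w v v
| alg_inv_density : profile_algebra c x w v (fun r => / x r)
| alg_enth' : profile_algebra c x w v (fun r => enth' c (x r))
| alg_plus f g : profile_algebra c x w v f -> profile_algebra c x w v g ->
    profile_algebra c x w v (fun r => f r + g r)
| alg_mult f g : profile_algebra c x w v f -> profile_algebra c x w v g ->
    profile_algebra c x w v (fun r => f r * g r)
| alg_ext f g : (forall r, 1 <= r -> f r = g r) -> profile_algebra c x w v f ->
    profile_algebra c x w v g.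

Lemma alg_opp c x w v f :
  profile_algebra c x w v f -> profile_algebra c x w v (fun r => - f r).
Proof.
  intros Hf. eapply alg_ext; [|apply (alg_mult c x w v _ _ (alg_const _ _ _ _ (-1)) Hf)].
  intros; simpl; ring.
Qed.

Lemma alg_minus c x w v f g : profile_algebra c x w v f ->
  profile_algebra c x w v g -> profile_algebra c x w v (fun r => f r - g r).
Proof. intros Hf Hg. now apply (alg_plus c x w v f _ Hf), alg_opp. Qed.

Lemma alg_pow c x w v f j :
  profile_algebra c x w v f -> profile_algebra c x w v (fun r => f r ^ j).
Proof.
  intros Hf. induction j as [|j IH]; simpl; [apply alg_const|now apply alg_mult].
Qed.

Lemma alg_inv_pow c x w v j : profile_algebra c x w v (fun r => / r ^ j).
Proof.
  eapply alg_ext; [|apply (alg_pow c x w v _ j (alg_inv_id c x w v))].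
  intros r Hr; simpl. apply pow_inv.
Qed.

Ltac in_algebra :=
  repeat first [ apply alg_const | apply alg_inv_id | apply alg_density
    | apply alg_first | apply alg_second | apply alg_inv_density | apply alg_enth'
    | apply alg_inv_pow | apply alg_minus | apply alg_plus | apply alg_mult
    | apply alg_opp | apply alg_pow ].

(** Powers of the density occur only through [enth'], whose derivative [(gam - 2) * enth' / x * w]
    is a product of generators, and the equation expresses the derivative of [v] polynomially in the
    generators. *)
Lemma alg_derivative c m x w v : profile c m x w v -> (forall r, 1 <= r -> 0 < x r) ->
  forall f, profile_algebra c x w v f ->
  exists df, profile_algebra c x w v df /\ hderiv f df.
Proof.
  intros (X & W & V) Hp f Hf.
  assert (H0 : forall r, 1 <= r -> x r <> 0)
    by (intros s Hs; specialize (Hp s Hs); lra).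
  induction Hf as [a| | | | | | |f g Hf (df & Af & Df) Hg (dg & Ag & Dg)
    |f g Hf (df & Af & Df) Hg (dg & Ag & Dg)|f g E Hf (df & Af & Df)].
  - eexists; split; [|apply hderiv_const]. in_algebra.
  - eexists; split; [|apply hderiv_inv_id]. in_algebra.
  - eexists; split; [|exact X]. in_algebra.
  - eexists; split; [|exact W]. in_algebra.
  - eexists; split; [|exact V]. unfold source, nonlin. in_algebra.
  - eexists; split; [|apply (hderiv_inv _ _ X H0)]. in_algebra.
  - exists (fun r => (gam c - 2) * enth' c (x r) * / x r * w r). split; [in_algebra|].
    eapply hderiv_ext; [| |apply (hderiv_scal (gam c) _ _
      (hderiv_Rpower x w (gam c - 2) X Hp))].
    + reflexivity.
    + intros r _; unfold enth'; simpl; ring.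
  - eexists; split; [|apply (hderiv_plus _ _ _ _ Df Dg)]. now apply alg_plus.
  - eexists; split; [|apply (hderiv_mult _ _ _ _ Df Dg)].
    apply alg_plus; now apply alg_mult.
  - exists df. split; [easy|]. now apply (hderiv_ext f g df df).
Qed.

Lemma alg_smooth c m x w v f : profile c m x w v -> (forall r, 1 <= r -> 0 < x r) ->
  profile_algebra c x w v f -> smooth_halfline f.
Proof.
  intros P Hp Hf.
  destruct (functional_choice
    (fun f g : {f | profile_algebra c x w v f} => hderiv (proj1_sig f) (proj1_sig g)))
    as [T HT].
  { intros [g Hg]. destruct (alg_derivative c m x w v P Hp g Hg) as (dg & A & D).
    now exists (exist _ dg A). }
  pose (it := fix it k := match k with O => exist _ f Hf | S k => T (it k) end).
  exists (fun k => proj1_sig (it k)). split; [easy|]. intros k.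
  apply is_deriv_halfline_of_hderiv; [apply HT|].
  (* The next derivative is itself differentiable, hence continuous up to 1, as the one-sided
     derivative there requires. *)
  change (hcont (proj1_sig (it (S k)))). apply (HT (it (S k))).
Qed.

(** * Uniqueness: decaying solutions lie in the ball *)

Lemma Rabs_mult_le a b A B : Rabs a <= A -> Rabs b <= B -> Rabs (a * b) <= A * B.
Proof.
  intros Ha Hb. rewrite Rabs_mult. apply Rmult_le_compat; auto using Rabs_pos.
Qed.

Lemma inv_pow_double c r :
  (/ r ^ codim c) ^ 2 * / r = / r ^ (2 * codim c + 1).
Proof.
  rewrite pow_add, pow_1, Rinv_mult. f_equal.
  now rewrite Nat.mul_comm, pow_mult, pow_inv.
Qed.

(* The combination whose derivative does not involve the second derivative of
   the density. *)
Definition reduced (c : coeffs) (m : R) (x w v : R -> R) (r : R) : R :=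
  v r + (NN c * / r - visc c * m / capil c * ((/ x r) ^ 3 * / r ^ codim c)) * w r.

Definition reduced' (c : coeffs) (m : R) (x w : R -> R) (r : R) : R :=
  / capil c *
  (enth' c (x r) * w r
   - m * m * (w r * ((/ x r) ^ 3 * (/ r ^ codim c) ^ 2)
              + NN c * (/ x r) ^ 2 * / r ^ (2 * codim c + 1))
   + visc c * m * (w r * w r * ((/ x r) ^ 4 * / r ^ codim c))).

(** [v + NN / r * w] is the radial Laplacian of the density, so its derivative absorbs both linear
    curvature terms. The viscous term is a total derivative up to the term quadratic in [w] that
    [reduced'] retains. *)
Lemma hderiv_reduced c m x w v : admissible c ->
  profile c m x w v -> (forall r, 1 <= r -> 0 < x r) ->
  hderiv (reduced c m x w v) (reduced' c m x w).
Proof.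
  intros H (X & W & V) Hp.
  assert (H0 : forall r, 1 <= r -> x r <> 0)
    by (intros s Hs; specialize (Hp s Hs); lra).
  assert (Hc : 0 < capil c) by apply H.
  pose proof (hderiv_inv _ _ X H0) as I.
  eapply hderiv_ext; [| |apply (hderiv_plus _ _ _ _ V (hderiv_mult _ _ _ _
    (hderiv_minus _ _ _ _ (hderiv_scal (NN c) _ _ hderiv_inv_id)
      (hderiv_scal (visc c * m / capil c) _ _
        (hderiv_mult _ _ _ _ (hderiv_mult _ _ _ _ I (hderiv_mult _ _ _ _ I I))
          (hderiv_inv_pow (codim c))))) W))].
  - intros r Hr. unfold reduced. simpl pow. ring.
  - intros r Hr. unfold reduced', source, nonlin, alpha.
    rewrite <- inv_pow_double. unfold NN.
    set (y := / x r). set (a := / r ^ codim c). set (b := / r).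
    set (h := enth' c (x r)). set (h0 := enth' c (rho_inf c)).
    cbv beta. fold y a b. field. lra.
Qed.

Lemma inv_pow_antitone r s j : 1 <= r <= s -> / s ^ j <= / r ^ j.
Proof.
  intros H. apply Rinv_le_contravar; [apply pow_lt; lra|apply pow_incr; lra].
Qed.

(** Each term yields one factor [E] and one power [/ r ^ (2 * codim + 1)]: the enthalpy term through
    [w], the convective one through [u^2 <= E], and the viscous one through [w^2], whose surplus
    factor is at most 1. *)
Lemma reduced'_bound c C0 : admissible c -> 0 <= C0 -> exists K, 0 <= K /\
  forall u E M x w,
  Rabs u <= 1 -> Rabs u ^ 2 <= E <= 1 -> Rabs M <= 2 * rho_inf c ->
  forall r, 1 <= r -> Rabs (x r - rho_inf c) <= rho_inf c / 2 ->
  Rabs (w r) <= C0 * E * / r ^ (2 * codim c + 1) ->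
  Rabs (reduced' c (M * u) x w r) <= K * E * / r ^ (2 * codim c + 1).
Proof.
  intros H HC0. assert (HR : 0 < rho_inf c) by apply H.
  assert (Hc : 0 < / capil c) by (apply Rinv_0_lt_compat, H).
  assert (Hv : 0 < visc c) by apply H. pose proof (NN_ge1 c H) as HN.
  set (Y := 2 / rho_inf c). assert (HY : 0 < Y) by (apply Rdiv_lt_0_compat; lra).
  set (G := exp (Rabs (gam c - 2) *
     (Rabs (ln (rho_inf c / 2)) + Rabs (ln (2 * rho_inf c))))).
  assert (HG : 0 < G) by apply exp_pos.
  assert (Hg : 0 < gam c) by (destruct H as (_ & A & _); lra).
  pose proof (pow_lt Y 2 HY) as HY2. pose proof (pow_lt Y 3 HY) as HY3.
  pose proof (pow_lt Y 4 HY) as HY4.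
  set (R2 := 2 * rho_inf c).
  exists (/ capil c * (gam c * G * C0 + R2 * R2 * (C0 * Y ^ 3 + NN c * Y ^ 2)
     + visc c * R2 * (C0 * C0 * Y ^ 4))).
  split.
  { unfold R2. apply Rmult_le_pos; [lra|].
    apply Rplus_le_le_0_compat; [apply Rplus_le_le_0_compat|];
      repeat first [lra|apply Rmult_le_pos|apply Rplus_le_le_0_compat]. }
  intros u E M x w Hu HE HM r Hr Hx Hw.
  apply Rabs_le_between in Hx.
  assert (Hy : Rabs (/ x r) <= Y).
  { rewrite Rabs_pos_eq by (left; apply Rinv_0_lt_compat; lra).
    replace Y with (/ (rho_inf c / 2)) by (unfold Y; field; lra).
    apply Rinv_le_contravar; lra. }
  assert (HyP : forall j, Rabs ((/ x r) ^ j) <= Y ^ j).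
  { intros j. rewrite <- RPow_abs. apply pow_incr. split; [apply Rabs_pos|easy]. }
  assert (He : Rabs (enth' c (x r)) <= gam c * G).
  { apply Rabs_mult_le; [rewrite Rabs_pos_eq; lra|].
    apply Rabs_Rpower_le; lra. }
  set (e := / r ^ (2 * codim c + 1)) in *.
  destruct (inv_pow_le1 r (2 * codim c + 1) Hr) as [He0 He1]. fold e in He0, He1.
  assert (Ha : forall j, Rabs ((/ r ^ codim c) ^ j) <= 1).
  { intros j. destruct (inv_pow_le1 r (codim c) Hr).
    rewrite <- RPow_abs, <- (pow1 j). apply pow_incr. split; [apply Rabs_pos|].
    rewrite Rabs_pos_eq; lra. }
  assert (HE0 : 0 <= E) by (pose proof (pow_le (Rabs u) 2 (Rabs_pos u)); lra).
  assert (HEe : 0 <= E * e <= 1).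
  { split; [apply Rmult_le_pos; lra|].
    rewrite <- (Rmult_1_r 1). apply Rmult_le_compat; lra. }
  assert (T1 : Rabs (enth' c (x r) * w r) <= gam c * G * (C0 * E * e))
    by now apply Rabs_mult_le.
  assert (Hm2 : Rabs (M * u * (M * u)) <= R2 * R2 * E).
  { replace (M * u * (M * u)) with (M * M * u ^ 2) by ring.
    apply Rabs_mult_le; [now apply Rabs_mult_le|].
    rewrite <- RPow_abs. apply HE. }
  assert (T2 : Rabs (M * u * (M * u) * (w r * ((/ x r) ^ 3 * (/ r ^ codim c) ^ 2)
       + NN c * (/ x r) ^ 2 * e)) <= R2 * R2 * E * ((C0 * Y ^ 3 + NN c * Y ^ 2) * e)).
  { assert (T : Rabs (w r * ((/ x r) ^ 3 * (/ r ^ codim c) ^ 2)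
       + NN c * (/ x r) ^ 2 * e) <= (C0 * Y ^ 3 + NN c * Y ^ 2) * e).
    { eapply Rle_trans; [apply Rabs_triang|]. rewrite Rmult_plus_distr_r.
      apply Rplus_le_compat.
      - apply Rle_trans with (C0 * E * e * (Y ^ 3 * 1)).
        + apply Rabs_mult_le; [easy|]. now apply Rabs_mult_le.
        + replace (C0 * E * e * (Y ^ 3 * 1)) with (C0 * Y ^ 3 * e * E) by ring.
          rewrite <- (Rmult_1_r (C0 * Y ^ 3 * e)) at 2.
          apply Rmult_le_compat_l; [repeat first [lra|apply Rmult_le_pos]|lra].
      - apply Rabs_mult_le.
        + apply Rabs_mult_le; [rewrite Rabs_pos_eq; lra|easy].
        + rewrite Rabs_pos_eq; lra. }
    now apply Rabs_mult_le. }
  assert (HMu : Rabs (M * u) <= R2 * 1) by now apply Rabs_mult_le.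
  assert (T3 : Rabs (visc c * (M * u) * (w r * w r * ((/ x r) ^ 4 * / r ^ codim c)))
     <= visc c * R2 * (C0 * C0 * Y ^ 4) * (E * e)).
  { apply Rle_trans with (visc c * (R2 * 1) * (C0 * E * e * (C0 * E * e) * (Y ^ 4 * 1))).
    - apply Rabs_mult_le.
      + apply Rabs_mult_le; [rewrite Rabs_pos_eq; lra|easy].
      + apply Rabs_mult_le; [now apply Rabs_mult_le|].
        apply Rabs_mult_le; [easy|]. specialize (Ha 1%nat). now rewrite pow_1 in Ha.
    - replace (visc c * (R2 * 1) * (C0 * E * e * (C0 * E * e) * (Y ^ 4 * 1)))
        with (visc c * R2 * (C0 * C0 * Y ^ 4) * (E * e) * (E * e)) by ring.
      rewrite <- (Rmult_1_r (visc c * R2 * (C0 * C0 * Y ^ 4) * (E * e))) at 2.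
      apply Rmult_le_compat_l; [|lra].
      unfold R2. repeat first [lra|apply Rmult_le_pos]. }
  unfold reduced'. fold e.
  rewrite (Rmult_assoc _ E e), (Rmult_assoc (/ capil c) _ (E * e)).
  apply Rabs_mult_le; [rewrite Rabs_pos_eq; lra|].
  eapply Rle_trans; [apply Rabs_triang|].
  eapply Rle_trans; [apply Rplus_le_compat_r, Rabs_triang|]. rewrite Rabs_Ropp.
  lra.
Qed.

Lemma second_derivative_bound c C0 : admissible c -> 0 <= C0 -> exists K, 0 <= K /\
  forall u E M x w v,
  Rabs u <= 1 -> Rabs u ^ 2 <= E <= 1 -> Rabs M <= 2 * rho_inf c ->
  profile c (M * u) x w v ->
  (forall r, 1 <= r -> Rabs (x r - rho_inf c) <= rho_inf c / 2) ->
  (forall r, 1 <= r -> Rabs (w r) <= C0 * E * / r ^ (2 * codim c + 1)) ->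
  forall r, 1 <= r -> Rabs (v r) <= K * E * / r ^ (2 * codim c + 1).
Proof.
  intros H HC0. destruct (reduced'_bound c C0 H HC0) as [K1 [HK1 HK]].
  assert (HR : 0 < rho_inf c) by apply H.
  assert (Hc : 0 < / capil c) by (apply Rinv_0_lt_compat, H).
  assert (Hv : 0 < visc c) by apply H. pose proof (NN_ge1 c H) as HN.
  set (Y := 2 / rho_inf c). assert (HY : 0 < Y) by (apply Rdiv_lt_0_compat; lra).
  pose proof (pow_lt Y 3 HY) as HY3.
  set (K2 := NN c + visc c * (2 * rho_inf c) * / capil c * Y ^ 3).
  assert (HK2 : 0 <= K2).
  { unfold K2. apply Rplus_le_le_0_compat; [lra|]. repeat first [lra|apply Rmult_le_pos]. }
  (* [2 * C0] bounds [v] at the mean value point [t], [K1] the change of [reduced] between [r] and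
     [t], and [K2 * C0] the difference of [reduced] and [v], which is paid at both points. *)
  exists (K1 + 2 * C0 + 2 * (K2 * C0)).
  assert (HKC : 0 <= K2 * C0) by now apply Rmult_le_pos.
  split; [lra|].
  intros u E M x w v Hu HE HM P Hx Hw.
  assert (Hp : forall r, 1 <= r -> 0 < x r).
  { intros r Hr. specialize (Hx r Hr). apply Rabs_le_between in Hx. lra. }
  pose proof (hderiv_reduced c (M * u) x w v H P Hp) as HD.
  assert (HE0 : 0 <= E) by (pose proof (pow_le (Rabs u) 2 (Rabs_pos u)); lra).
  set (e := fun r => / r ^ (2 * codim c + 1)).
  assert (Hdiff : forall r, 1 <= r ->
    Rabs (reduced c (M * u) x w v r - v r) <= K2 * C0 * (E * e r)).
  { intros r Hr. unfold reduced.
    match goal with |- Rabs (_ + ?a * _ - _) <= _ =>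
      replace (v r + a * w r - v r) with (a * w r) by ring end.
    replace (K2 * C0 * (E * e r)) with (K2 * (C0 * E * e r)) by ring.
    apply Rabs_mult_le; [|now apply Hw].
    eapply Rle_trans; [apply Rabs_triang|]. rewrite Rabs_Ropp.
    destruct (inv_pow_le1 r 1 Hr) as [I0 I1]. rewrite pow_1 in I0, I1.
    destruct (inv_pow_le1 r (codim c) Hr) as [J0 J1].
    assert (Hy : Rabs (/ x r) <= Y).
    { specialize (Hx r Hr). apply Rabs_le_between in Hx.
      rewrite Rabs_pos_eq by (left; apply Rinv_0_lt_compat; lra).
      replace Y with (/ (rho_inf c / 2)) by (unfold Y; field; lra).
      apply Rinv_le_contravar; lra. }
    apply Rplus_le_compat.
    - rewrite <- (Rmult_1_r (NN c)) at 2.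
      apply Rabs_mult_le; rewrite Rabs_pos_eq; lra.
    - apply Rle_trans with (visc c * (2 * rho_inf c * 1) * / capil c * (Y ^ 3 * 1)); [|lra].
      apply Rabs_mult_le; [apply Rabs_mult_le; [apply Rabs_mult_le|]|apply Rabs_mult_le].
      + rewrite Rabs_pos_eq; lra.
      + now apply Rabs_mult_le.
      + rewrite Rabs_pos_eq; lra.
      + rewrite <- RPow_abs. apply pow_incr. split; [apply Rabs_pos|easy].
      + rewrite Rabs_pos_eq; lra. }
  intros r Hr. fold (e r).
  assert (Hmon : forall s, r <= s -> E * e s <= E * e r).
  { intros s Hs. apply Rmult_le_compat_l; [easy|]. apply inv_pow_antitone. lra. }
  destruct P as (X & W & V).
  destruct (hderiv_MVT w v r (r + 1) W ltac:(lra)) as [t [Ht Et]].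
  destruct (hderiv_MVT _ _ r t HD ltac:(lra)) as [t' [Ht' Et']].
  assert (A1 : Rabs (v t) <= 2 * C0 * (E * e r)).
  { replace (v t) with (w (r + 1) - w r) by (rewrite Et; ring).
    eapply Rle_trans; [apply Rabs_triang|]. rewrite Rabs_Ropp.
    pose proof (Hw r Hr) as B1. pose proof (Hw (r + 1) ltac:(lra)) as B2.
    fold (e r) in B1. fold (e (r + 1)) in B2.
    assert (C0 * (E * e (r + 1)) <= C0 * (E * e r))
      by (apply Rmult_le_compat_l; [easy|apply Hmon; lra]).
    lra. }
  assert (A2 : Rabs (reduced c (M * u) x w v t - v t) <= K2 * C0 * (E * e r)).
  { eapply Rle_trans; [apply Hdiff; lra|].
    apply Rmult_le_compat_l; [easy|apply Hmon; lra]. }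
  pose proof (Hdiff r Hr) as A3.
  assert (A4 : Rabs (reduced c (M * u) x w v t - reduced c (M * u) x w v r)
               <= K1 * (E * e r)).
  { rewrite Et'.
    replace (K1 * (E * e r)) with (K1 * (E * e r) * 1) by ring.
    apply Rabs_mult_le; [|rewrite Rabs_pos_eq; lra].
    eapply Rle_trans; [apply (HK u E M x w Hu HE HM); [lra|apply Hx; lra|apply Hw; lra]|].
    fold (e t'). rewrite Rmult_assoc. apply Rmult_le_compat_l; [easy|apply Hmon; lra]. }
  set (yt := reduced c (M * u) x w v t) in *. set (yr := reduced c (M * u) x w v r) in *.
  apply Rabs_le_between in A1. apply Rabs_le_between in A2.
  apply Rabs_le_between in A3. apply Rabs_le_between in A4.
  apply Rabs_le. lra.
Qed.

Lemma inv_pow_le_Phi c r : admissible c -> 1 <= r ->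
  / r ^ (2 * codim c) <= (1 + shift c) ^ (2 * codim c) * (2 * NN c) * Phi c r.
Proof.
  intros H Hr. pose proof (shift_pos c H). pose proof (NN_ge1 c H). unfold Phi.
  set (j := (2 * codim c)%nat).
  assert (Hp : 0 < r ^ j) by (apply pow_lt; lra).
  assert (Hq : 0 < (r + shift c) ^ j) by (apply pow_lt; lra).
  assert (A : (r + shift c) ^ j <= (1 + shift c) ^ j * r ^ j).
  { rewrite <- Rpow_mult_distr. apply pow_incr. split; [lra|].
    assert (shift c * 1 <= shift c * r) by (apply Rmult_le_compat_l; lra). lra. }
  apply (Rmult_le_reg_r (r ^ j * (r + shift c) ^ j)).
  - now apply Rmult_lt_0_compat.
  - replace (/ r ^ j * (r ^ j * (r + shift c) ^ j)) with ((r + shift c) ^ j)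
      by (field; lra).
    replace ((1 + shift c) ^ j * (2 * NN c) *
       (/ (2 * NN c) * / (r + shift c) ^ j) * (r ^ j * (r + shift c) ^ j))
      with ((1 + shift c) ^ j * r ^ j) by (field; lra).
    easy.
Qed.

Lemma in_ball_mono c B B' x p q : admissible c -> B <= B' ->
  in_ball c B x p q -> in_ball c B' x p q.
Proof.
  intros H HB [Hh Hb]. split; [easy|]. intros r Hr.
  destruct (Hb r Hr) as (A1 & A2 & A3).
  pose proof (phi_pos c r H Hr). pose proof (Phi_pos c r H Hr).
  pose proof (lam_ge1 c H).
  assert (B * phi c r <= B' * phi c r) by (apply Rmult_le_compat_r; lra).
  assert (B / lam c * Phi c r <= B' / lam c * Phi c r).
  { apply Rmult_le_compat_r; [lra|]. apply Rmult_le_compat_r; [|lra].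
    left; apply Rinv_0_lt_compat; lra. }
  lra.
Qed.

Lemma in_ball_of_decay c C0 : admissible c -> 0 <= C0 -> exists C, 0 <= C /\
  forall u E M x w v,
  Rabs u <= 1 -> Rabs u ^ 2 <= E <= 1 -> Rabs M <= 2 * rho_inf c ->
  profile c (M * u) x w v ->
  (forall r, 1 <= r -> Rabs (x r - rho_inf c) <= rho_inf c / 2) ->
  (forall r, 1 <= r -> Rabs (x r - rho_inf c) <= C0 * E * / r ^ (2 * codim c)) ->
  (forall r, 1 <= r -> Rabs (w r) <= C0 * E * / r ^ (2 * codim c + 1)) ->
  in_ball c (C * E) x (fun r => v r - lam c * w r) (fun r => v r + lam c * w r).
Proof.
  intros H HC0. destruct (second_derivative_bound c C0 H HC0) as [K [HK HB]].
  pose proof (lam_ge1 c H) as Hl. pose proof (NN_ge1 c H) as HN.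
  pose proof (shift_pos c H) as Hs.
  set (C1 := lam c * C0 * ((1 + shift c) ^ (2 * codim c) * (2 * NN c))).
  set (C2 := (K + lam c * C0) * (1 + shift c) ^ (2 * codim c + 1)).
  assert (HS : forall j, 0 <= (1 + shift c) ^ j) by (intros; apply pow_le; lra).
  assert (HlC : 0 <= lam c * C0) by (apply Rmult_le_pos; lra).
  assert (HC1 : 0 <= C1).
  { apply Rmult_le_pos; [easy|]. apply Rmult_le_pos; [apply HS|lra]. }
  assert (HC2 : 0 <= C2) by (apply Rmult_le_pos; [lra|apply HS]).
  exists (C1 + C2). split; [lra|].
  intros u E M x w v Hu HE HM P Hx Hx' Hw.
  assert (HE0 : 0 <= E) by (pose proof (pow_le (Rabs u) 2 (Rabs_pos u)); lra).
  pose proof (HB u E M x w v Hu HE HM P Hx Hw) as Hv.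
  destruct P as (X & W & V). split.
  - split; [apply X|].
    assert (hcont (fun r => lam c * w r))
      by (apply hcont_mult; [apply hcont_const|apply W]).
    split; [apply hcont_minus|apply hcont_plus]; try easy; apply V.
  - intros r Hr. pose proof (phi_pos c r H Hr) as Hf.
    pose proof (Phi_pos c r H Hr) as HF.
    assert (A : (K + lam c * C0) * E * / r ^ (2 * codim c + 1) <= (C1 + C2) * E * phi c r).
    { apply Rle_trans with (C2 * E * phi c r).
      - unfold C2.
        replace ((K + lam c * C0) * (1 + shift c) ^ (2 * codim c + 1) * E * phi c r)
          with ((K + lam c * C0) * E * ((1 + shift c) ^ (2 * codim c + 1) * phi c r))
          by ring.
        apply Rmult_le_compat_l; [apply Rmult_le_pos; lra|now apply inv_pow_le_phi].
      - apply Rmult_le_compat_r; [lra|]. apply Rmult_le_compat_r; lra. }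
    specialize (Hv r Hr). specialize (Hw r Hr). specialize (Hx' r Hr).
    assert (Hlw : Rabs (lam c * w r) <= lam c * (C0 * E * / r ^ (2 * codim c + 1)))
      by (apply Rabs_mult_le; [rewrite Rabs_pos_eq; lra|easy]).
    split; [|split].
    + eapply Rle_trans; [exact Hx'|].
      apply Rle_trans with (C1 * E / lam c * Phi c r).
      * replace (C1 * E / lam c * Phi c r)
          with (C0 * E * ((1 + shift c) ^ (2 * codim c) * (2 * NN c) * Phi c r))
          by (unfold C1; field; lra).
        apply Rmult_le_compat_l; [apply Rmult_le_pos; lra|now apply inv_pow_le_Phi].
      * apply Rmult_le_compat_r; [lra|]. apply Rmult_le_compat_r.
        -- left; apply Rinv_0_lt_compat; lra.
        -- apply Rmult_le_compat_r; lra.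
    + eapply Rle_trans; [apply Rabs_triang|]. rewrite Rabs_Ropp. lra.
    + eapply Rle_trans; [apply Rabs_triang|]. lra.
Qed.

(** * Velocity bounds and the passage between solutions and profiles *)

(** Both densities lie between [rho_inf / 2] and [3 * rho_inf / 2], so their ratio lies between 1/3
    and 3. *)
Lemma velocity_bounds c x u r : admissible c ->
  (forall s, 1 <= s -> Rabs (x s - rho_inf c) <= rho_inf c / 2) -> 1 <= r ->
  / 3 * Rabs u * / r ^ codim c <= Rabs (velocity c (x 1 * u) x r)
    <= 3 * Rabs u * / r ^ codim c.
Proof.
  intros H Hx Hr. assert (HR : 0 < rho_inf c) by apply H.
  pose proof (Hx 1 (Rle_refl 1)) as A. pose proof (Hx r Hr) as B.
  apply Rabs_le_between in A. apply Rabs_le_between in B.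
  destruct (inv_pow_le1 r (codim c) Hr) as [He _].
  assert (Q : / 3 <= x 1 * / x r <= 3).
  { split.
    - apply (Rmult_le_reg_r (x r)); [lra|].
      rewrite Rmult_assoc, Rinv_l by lra. lra.
    - apply (Rmult_le_reg_r (x r)); [lra|].
      rewrite Rmult_assoc, Rinv_l by lra. lra. }
  assert (E : Rabs (velocity c (x 1 * u) x r)
              = x 1 * / x r * (Rabs u * / r ^ codim c)).
  { unfold velocity.
    replace (x 1 * u * / x r * / r ^ codim c)
      with (x 1 * / x r * (u * / r ^ codim c)) by ring.
    rewrite Rabs_mult, (Rabs_pos_eq (x 1 * / x r)), Rabs_mult,
      (Rabs_pos_eq (/ r ^ codim c)) by lra. easy. }
  rewrite E, !Rmult_assoc.
  assert (0 <= Rabs u * / r ^ codim c) by (apply Rmult_le_pos; [apply Rabs_pos|lra]).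
  split; rewrite <- ?Rmult_assoc, !(Rmult_assoc _ (Rabs u)).
  - apply Rmult_le_compat_r; lra.
  - apply Rmult_le_compat_r; lra.
Qed.

Lemma is_lim_inv_pow_bound (u : R -> R) (b : R) (j : nat) : (1 <= j)%nat ->
  (forall r, 1 <= r -> Rabs (u r) <= b * / r ^ j) -> is_lim u p_infty 0.
Proof.
  intros Hj Hb.
  assert (Hb0 : 0 <= b).
  { specialize (Hb 1 (Rle_refl 1)). rewrite pow1, Rinv_1 in Hb.
    pose proof (Rabs_pos (u 1)). lra. }
  assert (L : forall e, is_lim (fun r => e * / r) p_infty 0).
  { intros e. replace (Finite 0) with (Rbar_mult e 0) by (simpl; f_equal; ring).
    apply is_lim_scal_l. replace (Finite 0) with (Rbar_inv p_infty) by easy.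
    apply (is_lim_inv (fun r => r) p_infty p_infty); [apply is_lim_id|easy]. }
  apply (is_lim_le_le_loc (fun r => - b * / r) (fun r => b * / r)); [|apply L|apply L].
  exists 1. intros r Hr. specialize (Hb r ltac:(lra)).
  assert (b * / r ^ j <= b * / r).
  { apply Rmult_le_compat_l; [easy|]. apply Rinv_le_contravar; [lra|].
    rewrite <- (pow_1 r) at 1. apply Rle_pow; [lra|easy]. }
  apply Rabs_le_between in Hb. lra.
Qed.

Lemma exists_threshold a b : 0 <= a -> 0 < b ->
  exists d, 0 < d /\ forall t, t <= d -> a * t <= b.
Proof.
  intros Ha Hb. exists (b / (a + 1)). split; [apply Rdiv_lt_0_compat; lra|].
  intros t Ht. apply Rle_trans with (a * (b / (a + 1))).
  - now apply Rmult_le_compat_l.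
  - assert (0 < b / (a + 1)) by (apply Rdiv_lt_0_compat; lra).
    replace b with ((a + 1) * (b / (a + 1))) at 2 by (field; lra). lra.
Qed.

Lemma stationary_solution_of_profile c rb u x w v : admissible c ->
  profile c (x 1 * u) x w v -> w 1 = rb ->
  (forall r, 1 <= r -> Rabs (x r - rho_inf c) <= rho_inf c / 2) ->
  is_lim x p_infty (rho_inf c) ->
  stationary_solution (S (codim c)) (gam c) (visc c) (capil c) (rho_inf c) rb u
    x (velocity c (x 1 * u) x).
Proof.
  intros H P I Hx Lx. assert (HR : 0 < rho_inf c) by apply H.
  assert (Hp : forall r, 1 <= r -> 0 < x r).
  { intros r Hr. specialize (Hx r Hr). apply Rabs_le_between in Hx. lra. }
  repeat split.
  - apply (alg_smooth c _ x w v x P Hp). in_algebra.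
  - apply (alg_smooth c _ x w v _ P Hp). unfold velocity. in_algebra.
  - exact Hp.
  - intros r Hr. apply (continuity_eq_velocity c (x 1 * u)); easy.
  - intros r Hr. destruct P as (X & W & V).
    now apply (momentum_eq_iff c (x 1 * u) x w v _ _ r H X W V Hp (fun _ _ => eq_refl) Hr).
  - exact Lx.
  - destruct H as (Hk & H').
    apply (is_lim_inv_pow_bound _ (3 * Rabs u) (codim c) Hk).
    intros r Hr. now apply (velocity_bounds c x u r (conj Hk H')).
  - unfold velocity. rewrite pow1. field. specialize (Hp 1 (Rle_refl 1)). lra.
  - destruct P as (X & W & V).
    assert (D : D_in x w halfline 1).
    { apply is_deriv_halfline_of_hderiv; [easy|apply W|lra]. }
    unfold D_in in *. now rewrite I in D.
Qed.

Lemma profile_of_stationary_solution c rb um x u : admissible c ->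
  stationary_solution (S (codim c)) (gam c) (visc c) (capil c) (rho_inf c) rb um x u ->
  exists w v, profile c (x 1 * um) x w v /\ w 1 = rb /\ is_deriv_halfline x w /\
    forall r, 1 <= r -> u r = velocity c (x 1 * um) x r.
Proof.
  intros H ((F & EF & DF) & (U & EU & DU) & Hp & Hc & Hm & _ & _ & Eu1 & Db).
  pose proof (fun k => hderiv_of_is_deriv_halfline _ _ (DF k)) as HF.
  assert (X : hderiv x (F 1%nat))
    by (apply (hderiv_ext (F 0%nat) x (F 1%nat) (F 1%nat)); auto).
  assert (DU0 : hderiv u (U 1%nat)).
  { apply (hderiv_ext (U 0%nat) u (U 1%nat) (U 1%nat)); auto.
    now apply hderiv_of_is_deriv_halfline. }
  assert (Ev : forall r, 1 <= r -> u r = velocity c (x 1 * um) x r).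
  { rewrite <- Eu1. now apply (velocity_of_continuity_eq c x (F 1%nat) u (U 1%nat)). }
  assert (Dx : is_deriv_halfline x (F 1%nat))
    by (apply is_deriv_halfline_of_hderiv; [easy|apply HF]).
  exists (F 1%nat), (F 2%nat). split; [|split; [|split]]; try easy.
  - split; [easy|split; [apply HF|]].
    apply (hderiv_ext (F 2%nat) (F 2%nat) (F 3%nat)); [easy| |apply HF].
    intros r Hr.
    now apply (momentum_eq_iff c (x 1 * um) x (F 1%nat) (F 2%nat) (F 3%nat) u r H X
      (HF 1%nat) (HF 2%nat) Hp Ev Hr), Hm.
  - apply (D_in_halfline_unique x (F 1%nat) (fun _ => rb) 1); [lra|apply Dx; lra|easy].
Qed.

(** * Choice of the constants and conclusion *)

Lemma data_size_small rb u d :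
  d <= 1 -> Rabs rb < d -> Rabs u < d ->
  Rabs u <= 1 /\ Rabs u ^ 2 <= data_size rb u <= 2 * d.
Proof.
  intros Hd Hb Hu. pose proof (Rabs_pos rb). pose proof (Rabs_pos u).
  assert (Rabs u ^ 2 <= d * 1).
  { simpl. rewrite Rmult_1_r. apply Rmult_le_compat; lra. }
  unfold data_size. lra.
Qed.

Theorem theorem1p2 (n : nat) (gamma mu kappa rho_plus : R)
  (hn : (2 <= n)%nat) (hgamma : 1 <= gamma) (hmu : 0 < mu)
  (hkappa : 0 < kappa) (hrho_plus : 0 < rho_plus) :
  exists delta C : R, 0 < delta /\ 0 < C /\
    forall rho_b u_m : R,
      u_m <> 0 -> Rabs rho_b < delta -> Rabs u_m < delta ->
      exists rho u : R -> R,
        stationary_solution n gamma mu kappa rho_plus rho_b u_m rho u /\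
        decay_estimates n C rho_plus rho_b u_m rho u /\
        forall rho' u' : R -> R,
          stationary_solution n gamma mu kappa rho_plus rho_b u_m rho' u' ->
          decay_estimates n C rho_plus rho_b u_m rho' u' ->
          forall r, 1 <= r -> rho' r = rho r /\ u' r = u r.
Proof.
  destruct n as [|k]; [lia|].
  set (c := Coeffs k gamma mu kappa rho_plus).
  assert (H : admissible c) by (repeat split; simpl; lra || lia).
  assert (HR : 0 < rho_inf c) by easy.
  unfold decay_estimates.
  replace (S k - 1)%nat with (codim c) by (simpl; lia).
  replace (2 * S k - 1)%nat with (2 * codim c + 1)%nat by (simpl; lia).
  change (stationary_solution (S k) gamma mu kappa rho_plus) with
    (stationary_solution (S (codim c)) (gam c) (visc c) (capil c) (rho_inf c)).
  change rho_plus with (rho_inf c).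
  destruct (step_fixed_point c H) as (K1 & C1 & HK1 & HC1 & Hex).
  destruct (step_fixed_point_unique c H) as (K2 & HK2 & Huniq).
  (* [C1] serves the density and its slope, 3 the velocity. *)
  set (C := C1 + 3).
  destruct (in_ball_of_decay c C H ltac:(unfold C; lra)) as (C2 & HC2 & Hball).
  pose proof (slack_pos c H) as Hsl. pose proof (lam_ge1 c H) as Hl.
  (* A common radius: the ball of radius [CC * E] contains the constructed solution and every
     competitor that decays with constant [C]. *)
  set (CC := C + C1 + C2).
  (* Since [E <= 2 * delta], the radius [B = CC * E] is at most [2 * CC * delta]. The three
     thresholds keep the nonlinear terms within [slack], [B] below 1, and [B] below
     [rho_inf / 2]. *)
  destruct (exists_threshold ((K1 + K2) * (2 * CC + 1)) (slack c)) as (d1 & Hd1 & T1);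
    [apply Rmult_le_pos; unfold CC, C; lra|easy|].
  destruct (exists_threshold (2 * CC) 1) as (d2 & Hd2 & T2);
    [unfold CC, C; lra|lra|].
  destruct (exists_threshold (2 * CC) (rho_inf c / 2)) as (d3 & Hd3 & T3);
    [unfold CC, C; lra|lra|].
  (* The cap 1/2 gives [E <= 2 * delta <= 1]. *)
  set (delta := Rmin (Rmin (1 / 2) d1) (Rmin d2 d3)).
  assert (Hdelta : 0 < delta) by (repeat apply Rmin_pos; lra).
  exists delta, C. split; [easy|]. split; [unfold C; lra|].
  intros rb u Hu0 Hrb Hu.
  assert (Ha : delta <= Rmin (1 / 2) d1) by apply Rmin_l.
  assert (Hb : delta <= Rmin d2 d3) by apply Rmin_r.
  pose proof (Rmin_l (1 / 2) d1). pose proof (Rmin_r (1 / 2) d1).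
  pose proof (Rmin_l d2 d3). pose proof (Rmin_r d2 d3).
  specialize (T1 delta ltac:(lra)). specialize (T2 delta ltac:(lra)).
  specialize (T3 delta ltac:(lra)).
  destruct (data_size_small rb u delta ltac:(lra) Hrb Hu) as (Hu1 & HuE & HE).
  fold (data_size rb u). set (E := data_size rb u) in *.
  assert (HE0 : 0 <= E) by apply data_size_pos.
  assert (Hup : 0 <= Rabs u) by apply Rabs_pos.
  assert (HCCE : CC * E <= 2 * CC * delta).
  { replace (2 * CC * delta) with (CC * (2 * delta)) by ring.
    apply Rmult_le_compat_l; [unfold CC, C; lra|easy]. }
  set (B := CC * E).
  assert (HB0 : 0 <= B) by (apply Rmult_le_pos; [unfold CC, C; lra|easy]).
  assert (HsB : (K1 + K2) * (B + Rabs u) <= slack c).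
  { eapply Rle_trans; [|exact T1]. rewrite Rmult_assoc.
    apply Rmult_le_compat_l; [lra|]. unfold B. lra. }
  (* Existence is used at the smaller radius [C1 * E], so that the solution satisfies the estimates
     with [C]; uniqueness is used at radius [B]. *)
  assert (HKs : forall b, 0 <= b <= B ->
     K1 * (b + Rabs u) <= slack c /\ K2 * (b + Rabs u) <= slack c).
  { intros b Hb'.
    assert (K1 * (b + Rabs u) <= K1 * (B + Rabs u)) by (apply Rmult_le_compat_l; lra).
    assert (K2 * (b + Rabs u) <= K2 * (B + Rabs u)) by (apply Rmult_le_compat_l; lra).
    assert (0 <= K1 * (B + Rabs u)) by (apply Rmult_le_pos; lra).
    assert (0 <= K2 * (B + Rabs u)) by (apply Rmult_le_pos; lra).
    lra. }
  assert (HC1E : 0 <= C1 * E <= B).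
  { split; [apply Rmult_le_pos; lra|apply Rmult_le_compat_r; unfold CC, C; lra]. }
  assert (HC2E : 0 <= C2 * E <= B).
  { split; [apply Rmult_le_pos; lra|apply Rmult_le_compat_r; unfold CC, C; lra]. }
  assert (HCE : 0 <= C * E <= B).
  { split; [apply Rmult_le_pos; unfold C; lra
           |apply Rmult_le_compat_r; unfold CC, C; lra]. }
  fold B in HCCE.
  destruct (Hex u rb (C1 * E) Hu1 ltac:(lra) ltac:(lra) (proj1 (HKs _ HC1E))
    (Rle_refl _)) as (x & p & q & Kx & Sx).
  destruct (profile_of_step c u rb x p q H Sx) as [P I].
  set (w := fun r => (q r - p r) / (2 * lam c)) in *.
  set (v := fun r => (q r + p r) / 2) in *.
  assert (Hx : forall r, 1 <= r -> Rabs (x r - rho_inf c) <= rho_inf c / 2).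
  { intros r Hr. destruct Kx as [_ Kx]. destruct (Kx r Hr) as [A _].
    pose proof (Phi_scaled_le c (C1 * E) r H ltac:(lra) Hr). lra. }
  exists x, (velocity c (x 1 * u) x). split; [|split].
  - apply (stationary_solution_of_profile c rb u x w v); try easy.
    apply (is_lim_of_Phi_bound c (C1 * E / lam c)); [easy|].
    intros r Hr. now apply Kx.
  - exists w. split.
    { destruct P as (X & W & _).
      apply is_deriv_halfline_of_hderiv; [easy|apply W]. }
    intros r Hr. destruct Kx as [_ Kx]. destruct (Kx r Hr) as (A1 & A2 & A3).
    destruct (velocity_bounds c x u r H Hx Hr) as [V1 V2].
    destruct (inv_pow_le1 r (codim c) Hr) as [e0 _].
    pose proof (Phi_le c r H Hr) as L1. pose proof (phi_le c r H Hr) as L2.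
    pose proof (Phi_pos c r H Hr) as F0. pose proof (phi_pos c r H Hr) as f0.
    assert (HCC1 : C1 * E <= C * E) by (apply Rmult_le_compat_r; unfold C; lra).
    repeat split.
    + eapply Rle_trans; [exact A1|]. apply Rmult_le_compat; try lra.
      * apply Rdiv_le_0_compat; lra.
      * eapply Rle_trans; [apply div_ge1_le; lra|easy].
    + eapply Rle_trans; [apply half_diff_bound; eassumption|].
      apply Rle_trans with (C1 * E * phi c r).
      * apply div_ge1_le; [apply Rmult_le_pos; lra|easy].
      * apply Rmult_le_compat; lra.
    + eapply Rle_trans; [|exact V1].
      apply Rmult_le_compat_r; [lra|]. apply Rmult_le_compat_r; [lra|].
      apply Rinv_le_contravar; unfold C; lra.
    + eapply Rle_trans; [exact V2|].
      apply Rmult_le_compat_r; [lra|]. apply Rmult_le_compat_r; unfold C; lra.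
  - intros x' u' S' (w0 & Dw0 & Hdec) r Hr.
    destruct (profile_of_stationary_solution c rb u x' u' H S')
      as (w' & v' & P' & I' & D' & Eu').
    (* The derivative supplied by the decay estimates and the one supplied by smoothness must be
       identified, also at 1. *)
    assert (Ew : forall s, 1 <= s -> w0 s = w' s).
    { intros s Hs. apply (D_in_halfline_unique x'); auto. }
    assert (HE1 : Rabs u ^ 2 <= E <= 1) by lra.
    assert (Hx' : forall s, 1 <= s -> Rabs (x' s - rho_inf c) <= rho_inf c / 2).
    { intros s Hs. destruct (Hdec s Hs) as [A _].
      destruct (inv_pow_le1 s (2 * codim c) Hs).
      assert (C * E * / s ^ (2 * codim c) <= C * E * 1)
        by (apply Rmult_le_compat_l; lra).
      lra. }
    assert (Hbl : in_ball c (C2 * E) x' (fun s => v' s - lam c * w' s)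
                    (fun s => v' s + lam c * w' s)).
    { apply (Hball u E (x' 1)); try easy.
      - specialize (Hx' 1 (Rle_refl 1)). apply Rabs_le_between in Hx'.
        apply Rabs_le. lra.
      - intros s Hs. now apply Hdec.
      - intros s Hs. rewrite <- Ew by easy. now apply Hdec. }
    pose proof (step_of_profile c u rb x' w' v' H P' I') as Sx'.
    assert (Ex : forall s, 1 <= s -> x' s = x s).
    { apply (Huniq u rb B x' (fun s => v' s - lam c * w' s)
        (fun s => v' s + lam c * w' s) x p q Hu1 ltac:(lra) ltac:(lra)
        (proj2 (HKs B ltac:(lra)))); try easy.
      - apply (in_ball_mono c (C2 * E)); [easy|lra|easy].
      - apply (in_ball_mono c (C1 * E)); [easy|lra|easy]. }
    split; [now apply Ex|].
    rewrite Eu' by easy. unfold velocity. rewrite (Ex 1), (Ex r) by lra. easy.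
Qed.
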